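(* Let $n,m\in\mathbb{N}$, let $\omega:[0,1]^m\to[0,\infty)$ be an integrable function, let $1<p<\infty$ and $1<p_i<\infty$ for $i=1,\ldots,m$, with $1/p=1/p_1+\cdots+1/p_m$. Then the weighted multilinear Hardy operator $\mathcal{H}_{\omega}^m$ is bounded from $L^{p_1}(\mathbb{R}^n)\times\cdots\times L^{p_m}(\mathbb{R}^n)$ to $L^p(\mathbb{R}^n)$ if and only if $$\mathbb{A}_m:=\int_{0<t_1,\ldots,t_m<1}\left(\prod_{i=1}^m t_i^{-n/p_i}\right)\omega(t_1,\ldots,t_m)\,dt_1\cdots dt_m<\infty.$$ Moreover, $$\|\mathcal{H}_{\omega}^m\|_{L^{p_1}(\mathbb{R}^n)\times\cdots\times L^{p_m}(\mathbb{R}^n)\to L^p(\mathbb{R}^n)}=\mathbb{A}_m.$$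
   Context: For complex-valued measurable functions $f_1,\ldots,f_m$ on $\mathbb{R}^n$ and $\vec f=(f_1,\ldots,f_m)$, the weighted multilinear Hardy operator is $$\mathcal{H}_{\omega}^m(\vec f)(x):=\int_{0<t_1,\ldots,t_m<1}\left(\prod_{i=1}^m f_i(t_ix)\right)\omega(t_1,\ldots,t_m)\,dt_1\cdots dt_m,\qquad x\in\mathbb{R}^n.$$ A multilinear operator $T$ is bounded from $X_1\times\cdots\times X_m$ to $Y$ if there is a finite $C$ with $\|T(\vec f)\|_Y\le C\prod_{i=1}^m\|f_i\|_{X_i}$ for all $f_i\in X_i$; its operator norm is the least such $C$. *)

(* Defs.v *)
From HB Require Import structures.
From mathcomp Require Import all_boot all_order all_algebra.
From mathcomp Require Import all_classical all_reals all_analysis.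
From mathcomp Require Import complex.

Set Implicit Arguments.
Unset Strict Implicit.
Unset Printing Implicit Defensive.

Import Order.TTheory GRing.Theory Num.Theory.
Import numFieldNormedType.Exports.

Local Open Scope classical_set_scope.
Local Open Scope ring_scope.

Section power_measure.
Context d (T : measurableType d) (R : realType).
Variable mu : {sigma_finite_measure set T -> \bar R}.

Definition tcons n (xt : T * n.-tuple T) : n.+1.-tuple T :=
  [tuple of xt.1 :: xt.2].

Lemma measurable_tcons n : measurable_fun [set: T * n.-tuple T] (@tcons n).
Proof. exact: measurable_cons. Qed.

Section step.
Variables (n : nat) (nu : {sigma_finite_measure set (n.-tuple T) -> \bar R}).

Definition power_step : set (n.+1.-tuple T) -> \bar R :=
  pushforward (mu \x nu)%E (@tcons n).

Let mtcons_preimage (A : set (n.+1.-tuple T)) : measurable A ->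
  measurable (@tcons n @^-1` A).
Proof.
by move=> mA; rewrite -[X in measurable X]setTI; exact: measurable_tcons.
Qed.

Let power_step0 : power_step set0 = 0%E.
Proof. by rewrite /power_step /pushforward preimage_set0 measure0. Qed.

Let power_step_ge0 A : (0 <= power_step A)%E.
Proof. exact: integral_ge0. Qed.

Let power_step_semi_sigma_additive : semi_sigma_additive power_step.
Proof.
move=> F mF tF mUF; rewrite /power_step /pushforward preimage_bigcup.
apply: measure_semi_sigma_additive.
- by move=> i; exact: mtcons_preimage.
- apply/trivIsetP => /= i j _ _ ij; rewrite -preimage_setI.
  by move/trivIsetP : tF => /(_ _ _ _ _ ij) -> //; rewrite preimage_set0.
- by rewrite -preimage_bigcup; exact: mtcons_preimage.
Qed.

HB.instance Definition _ := isMeasure.Build _ _ _ power_step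
  power_step0 power_step_ge0 power_step_semi_sigma_additive.

Let power_step_sigma_finite : sigma_finite setT power_step.
Proof.
have /sigma_finiteP[F [UF ndF mF]] := sigma_finiteT mu.
have /sigma_finiteP[G [UG ndG mG]] := sigma_finiteT nu.
pose tsplit (t : n.+1.-tuple T) : T * n.-tuple T :=
  (thead t, [tuple of behead t]).
have tconsK xt : tsplit (tcons xt) = xt.
  by case: xt => x t; congr pair; exact/val_inj.
have mtsplit : measurable_fun setT tsplit.
  apply/measurable_fun_pairP; split; first exact: measurable_tnth.
  exact: measurable_behead.
exists (fun i => tsplit @^-1` (F i `*` G i)).
  rewrite -preimage_bigcup; apply/seteqP; split=> // t _ /=.
  have [i _ Fi] : (\bigcup_i F i) (thead t) by rewrite -UF.
  have [j _ Gj] : (\bigcup_i G i) [tuple of behead t] by rewrite -UG.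
  exists (maxn i j) => //; split.
    by move: Fi; exact/subsetPset/ndF/leq_maxl.
  by move: Gj; exact/subsetPset/ndG/leq_maxr.
move=> i; have [mFi Fioo] := mF i; have [mGi Gioo] := mG i; split.
  by rewrite -[X in measurable X]setTI; apply: mtsplit => //; exact: measurableX.
rewrite /power_step /pushforward -comp_preimage (_ : tsplit \o _ = id) //.
  by rewrite preimage_id product_measure1E// lte_mul_pinfty// ge0_fin_numE.
by apply/funext => x /=; rewrite tconsK.
Qed.

HB.instance Definition _ := @Measure_isSigmaFinite.Build _ _ _ power_step
  power_step_sigma_finite.

End step.

(* n-fold product of mu on n.-tuple T, equipped with the product sigma-algebra *)
Fixpoint power_measure n : {sigma_finite_measure set (n.-tuple T) -> \bar R} :=
  match n with
  | 0 => \d_([tuple] : 0.-tuple T)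
  | n'.+1 => power_step (power_measure n')
  end.

End power_measure.

Section lebesgue_Rn.
Context (R : realType) (n : nat).

Definition borel_lebesgue :
    {sigma_finite_measure set (n.-tuple (measurableTypeR R)) -> \bar R} :=
  power_measure lebesgue_measure n.

(* R^n with the sigma-algebra of Lebesgue measurable sets, obtained from the
   Borel measure by Caratheodory's construction. *)
Definition Rn : measurableType _ := caratheodory_type (borel_lebesgue^*)%mu.

Definition lebesgue_Rn : {measure set Rn -> \bar R} :=
  @completed_measure_extension _ _ _ borel_lebesgue.

Definition crd (x : Rn) (i : 'I_n) : R := tnth x i.

Definition dilate (a : R) (x : Rn) : Rn := [tuple (a * crd x i)%R | i < n].

Definition open_cube : set Rn := [set t | forall i, 0 < crd t i < 1].

Definition closed_cube : set Rn := [set t | forall i, 0 <= crd t i <= 1].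

End lebesgue_Rn.
Arguments lebesgue_Rn R n : clear implicits.
Arguments open_cube R n : clear implicits.
Arguments closed_cube R n : clear implicits.

Section complex_valued.
Context d (T : measurableType d) (R : realType).
Variable mu : {measure set T -> \bar R}.
Implicit Types (D : set T) (f : T -> R[i]).

Definition cmeasurable D f : Prop :=
  measurable_fun D (@complex.Re R \o f) /\ measurable_fun D (@complex.Im R \o f).

Definition cintegrable D f : Prop :=
  mu.-integrable D (EFin \o @complex.Re R \o f) /\
  mu.-integrable D (EFin \o @complex.Im R \o f).

Definition cintegral D f : R[i] :=
  Complex (\int[mu]_(x in D) complex.Re (f x)) (\int[mu]_(x in D) complex.Im (f x)).

Definition cLnorm (p : R) f : \bar R :=
  'N[mu]_(p%:E)[EFin \o @ComplexField.Normc.normc R \o f].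

Definition cLspace (p : R) : set (T -> R[i]) :=
  [set f | cmeasurable setT f /\ (cLnorm p f < +oo)%E].

End complex_valued.

Section multilinear_operator.
Context (R : realType) (n m : nat).
Variables (p : R) (ps : 'I_m -> R).

(* A multilinear operator acting on complex-valued functions on R^n is given by
   a total function op together with the set dom of the arguments at which it
   is well defined (elsewhere op takes junk values). *)
Variables (dom : set ('I_m -> Rn R n -> R[i]))
  (op : ('I_m -> Rn R n -> R[i]) -> Rn R n -> R[i]).

(* The real constants C such that op maps L^{ps 0} x ... x L^{ps (m - 1)} to L^p
   and has norm at most C. *)
Definition multilinear_bounds : set R :=
  [set C | 0 <= C /\
    forall f : 'I_m -> Rn R n -> R[i],
      (forall i, cLspace (lebesgue_Rn R n) (ps i) (f i)) ->
      [/\ dom f, cLspace (lebesgue_Rn R n) p (op f) &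
          (cLnorm (lebesgue_Rn R n) p (op f) <=
           C%:E * \prod_(i < m) cLnorm (lebesgue_Rn R n) (ps i) (f i))%E]].

Definition multilinear_bounded : Prop := multilinear_bounds !=set0.

(* +oo when the operator is unbounded *)
Definition operator_norm : \bar R := ereal_inf (EFin @` multilinear_bounds).

Lemma operator_norm_least : multilinear_bounded ->
  exists2 C, operator_norm = C%:E &
    multilinear_bounds C /\ forall C', multilinear_bounds C' -> C <= C'.
Proof.
set S := multilinear_bounds => -[C0 SC0].
have S_lb : has_lbound S by exists 0 => C [].
exists (inf S); first by rewrite /operator_norm ereal_inf_EFin//; exists C0.
split; last by move=> C' SC'; exact: ge_inf.
split=> [|f Lf]; first by apply: lb_le_inf => [|C []//]; exists C0.
have [domf Lpf _] := SC0.2 f Lf; split=> //.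
set P := (\prod_(i < m) _)%E.
have P_ge0 : (0 <= P)%E by apply: prode_ge0 => i _; exact: Lnorm_ge0.
have P_fin : P \is a fin_num.
  apply: prode_fin_num => i _; rewrite ge0_fin_numE; first exact: (Lf i).2.
  exact: Lnorm_ge0.
rewrite -(fineK P_fin); apply/lee_addgt0Pr => e e0.
have P1_gt0 : 0 < fine P + 1 by rewrite ltr_wpDl// fine_ge0.
have [C SC ltC] : exists2 C, S C & C < inf S + e / (fine P + 1).
  by apply: inf_adherent; [exact: divr_gt0 | split=> //; exists C0].
have [_ _] := SC.2 f Lf; rewrite -/P -(fineK P_fin) => /le_trans; apply.
rewrite -!EFinM -EFinD lee_fin.
apply: le_trans (ler_wpM2r (fine_ge0 P_ge0) (ltW ltC)) _.
rewrite mulrDl lerD2l mulrAC ler_pdivrMr// ler_pM2l// lerDl.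
exact: ler01.
Qed.

End multilinear_operator.

Section weighted_multilinear_Hardy_operator.
Context (R : realType) (n m : nat).
Variable omega : Rn R m -> R.
Implicit Types f : 'I_m -> Rn R n -> R[i].

Definition hardy_integrand f (x : Rn R n) (t : Rn R m) : R[i] :=
  (\prod_(i < m) f i (dilate (crd t i) x)) * (omega t)%:C%C.

Definition hardy f (x : Rn R n) : R[i] :=
  cintegral (lebesgue_Rn R m) (open_cube R m) (hardy_integrand f x).

(* the integral defining hardy f converges absolutely at almost every x *)
Definition hardy_dom : set ('I_m -> Rn R n -> R[i]) :=
  [set f | {ae lebesgue_Rn R n, forall x,
    cintegrable (lebesgue_Rn R m) (open_cube R m) (hardy_integrand f x)}].

Definition hardy_const (ps : 'I_m -> R) : \bar R :=
  (\int[lebesgue_Rn R m]_(t in open_cube R m)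
    ((\prod_(i < m) crd t i `^ (- (n%:R / ps i))) * omega t)%R%:E)%E.

End weighted_multilinear_Hardy_operator.

Arguments hardy {R} n {m} omega.
Arguments hardy_dom {R} n {m} omega.
Arguments hardy_const {R} n {m} omega ps.

(* Main.v *)
(* Upper bound: Hoelder's inequality with respect to the measure c(t) omega(t) dt,
   where c(t) = prod_i t_i^(-n/p_i), bounds |H f(x)|^p by A^(p-1) times the
   integral of (prod_i |f_i(t_i x)| / c(t))^p c(t) omega(t); integrating in x first
   (Tonelli), Hoelder's inequality for m functions and the scaling of Lebesgue
   measure give A^p prod_i ||f_i||^p.
   Lower bound: for f_i(x) = |x|^(-n/p_i) on the shell 1 < |x| <= r^k (sup norm)
   and 0 elsewhere, H f(x) >= A_r |x|^(-n/p) on r < |x| <= r^k, where A_r is the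
   part of the integral A over 1/r < t_i < 1. By scaling, |x|^(-n) has the same
   integral over every shell r^j < |x| <= r^(j+1), so any bound C satisfies
   A_r^p (k - 1) <= C^p k; let k and then r tend to infinity. *)
Require Import Defs.
From HB Require Import structures.
From mathcomp Require Import all_boot all_order all_algebra.
From mathcomp Require Import all_classical all_reals all_analysis.
From mathcomp Require Import measurable_realfun complex.
From mathcomp Require Import ring lra.

Set Implicit Arguments.
Unset Strict Implicit.
Unset Printing Implicit Defensive.

Import Order.TTheory GRing.Theory Num.Theory.
Import numFieldNormedType.Exports.

Local Open Scope classical_set_scope.
Local Open Scope ring_scope.

(** Elements of L^p are measurable only for the completed sigma-algebra, and the composite of such a
    function with (x, t) -> t_i x need not be measurable for the product of the two Lebesgue
    sigma-algebras. So omega and every f_i are replaced by Borel functions equal to them off null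
    sets, and all estimates are made for the Borel product. The replacement is harmless because
    dilations preserve null sets: by Tonelli, for almost every x the points t_i x avoid a given null
    set for almost every t with t_i > 0. The upper estimate also gives absolute convergence of the
    integral at almost every x, which boundedness includes here. The exponents of the test functions
    are forced: without a cutoff, the powers |x|^(-n/p_i) would formally give H f = A |x|^(-n/p),
    but they fail to lie in L^(p_i), by a logarithmic divergence. After the cutoff some points t_i x
    fall out of the shell; keeping only t_i > 1/r confines this loss to the innermost of the k
    shells, a proportion that vanishes as k grows. The sup norm is chosen because its balls are
    cubes of explicit measure. *)

(** * Completion of a sigma-finite measure *)

Section completion.
Local Open Scope ereal_scope.
Context d (T : measurableType d) (R : realType).
Variable mu : {sigma_finite_measure set T -> \bar R}.

Let cT : measurableType _ := caratheodory_type (mu^*)%mu.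
Let cmu : {measure set cT -> \bar R} :=
  @completed_measure_extension _ _ _ mu.

Lemma completion_measurable (A : set T) :
  measurable A -> @measurable _ cT A.
Proof. exact: caratheodory_measurable_mu_ext. Qed.

Lemma completion_measureE (A : set T) : measurable A -> cmu A = mu A.
Proof. exact: measurable_mu_extE. Qed.

Lemma completion_complete : measure_is_complete cmu.
Proof. exact: measure_is_complete_caratheodory. Qed.

(** The outer measure is an infimum over countable measurable covers; covers with excess at most
    1/(k+1) are intersected over all k. *)
Lemma measurable_hull (A : set T) : (mu^*)%mu A < +oo ->
  exists B, [/\ measurable B, A `<=` B & mu B = (mu^*)%mu A].
Proof.
move=> Aoo.
have Afin : (mu^*)%mu A \is a fin_num by rewrite ge0_fin_numE// mu_ext_ge0.
have cover k : exists2 G, measurable G /\ A `<=` G &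
    mu G <= (mu^*)%mu A + k.+1%:R^-1%:E.
  have k0 : (0 < k.+1%:R^-1 :> R)%R by rewrite invr_gt0.
  have [_ [F [mF AF] <-] lt] := lb_ereal_inf_adherent k0 Afin.
  exists (\bigcup_i F i); first by split => //; exact: bigcupT_measurable.
  apply: le_trans (ltW lt).
  by apply: measure_sigma_subadditive => //; exact: bigcupT_measurable.
pose G k := projT1 (cid2 (cover k)).
have mG k : measurable (G k) by rewrite /G; case: cid2 => ? [].
have AG k : A `<=` G k by rewrite /G; case: cid2 => ? [].
have muG k : mu (G k) <= (mu^*)%mu A + k.+1%:R^-1%:E by rewrite /G; case: cid2.
have mcap : measurable (\bigcap_k G k) by exact: bigcapT_measurable.
exists (\bigcap_k G k); split => //; first by move=> x Ax k _; exact: AG.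
apply/eqP; rewrite eq_le; apply/andP; split; last first.
  rewrite -(measurable_mu_extE mu mcap); apply: le_mu_ext => x Ax k _.
  exact: AG.
apply/lee_addgt0Pr => e e0.
near \oo => k.
apply: (@le_trans _ _ (mu (G k))).
  by apply: le_measure; rewrite ?inE//; exact: bigcap_inf.
apply: le_trans (muG k) _; rewrite leeD2l// lee_fin ltW//.
by near: k; exact: near_infty_natSinv_lt (PosNum e0).
Unshelve. all: by end_near. Qed.

Lemma null_hull (A : set T) : (mu^*)%mu A = 0 ->
  exists B, [/\ measurable B, A `<=` B & mu B = 0].
Proof. by move=> A0; have [|B] := @measurable_hull A; rewrite A0 => //; exists B. Qed.

Lemma completion_negligible (A : set T) : cmu.-negligible A -> mu.-negligible A.
Proof.
move=> [B [mB B0 AB]].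
by have [C [mC BC C0]] := null_hull B0; exists C; split => //; exact: subset_trans BC.
Qed.

Lemma negligible_completion (A : set T) : mu.-negligible A -> cmu.-negligible A.
Proof.
move=> [B [mB B0 AB]]; exists B; split => //; first exact: completion_measurable.
by rewrite completion_measureE.
Qed.

(** A set of finite measure differs from its hull by a null set; deleting a null hull of that
    difference leaves the same set from both. Sigma-finiteness reduces the general case to countably
    many such pieces. *)
Lemma completion_setD_null (A : set T) : @measurable _ cT A ->
  exists N, [/\ measurable N, mu N = 0 & measurable (A `\` N)].
Proof.
move=> mA.
have finite_case (E : set T) : @measurable _ cT E -> cmu E < +oo ->
    exists N, [/\ measurable N, mu N = 0 & measurable (E `\` N)].
  move=> mE Eoo; have [B [mB EB BE]] := measurable_hull Eoo.
  have : cmu (B `\` E) = 0.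
    rewrite measureD//=; last 2 first.
      exact: completion_measurable.
      by rewrite completion_measureE// BE.
    rewrite setIidr// completion_measureE// BE subee//.
    by rewrite ge0_fin_numE// mu_ext_ge0.
  move=> /null_hull[N [mN BEN N0]]; exists N; split => //.
  rewrite (_ : E `\` N = B `\` N); first exact: measurableD.
  apply/seteqP; split => [x [/EB]//|x [Bx Nx]]; split => //.
  by apply: contrapT => Ex; apply: Nx; apply: BEN.
have /sigma_finiteP[F [UF _ mF]] := sigma_finiteT mu.
have piece i : exists N, [/\ measurable N, mu N = 0 &
    measurable ((A `&` F i) `\` N)].
  have mFi : @measurable _ cT (F i) by apply: completion_measurable; case: (mF i).
  apply: finite_case; first exact: measurableI.
  have Foo : cmu (F i) < +oo by rewrite completion_measureE; case: (mF i).
  by apply: le_lt_trans Foo; apply: le_measure; rewrite ?inE//; exact: measurableI.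
pose N i := projT1 (cid (piece i)).
have mN i : measurable (N i) by rewrite /N; case: cid => ? [].
have N0 i : mu (N i) = 0 by rewrite /N; case: cid => ? [].
have mAN i : measurable ((A `&` F i) `\` N i) by rewrite /N; case: cid => ? [].
have mUN : measurable (\bigcup_i N i) by exact: bigcupT_measurable.
exists (\bigcup_i N i); split => //.
  apply/(negligibleP mu mUN)/negligible_bigcup => i.
  by exists (N i); split; [exact: mN|exact: N0|].
rewrite (_ : _ `\` _ = \bigcup_i (((A `&` F i) `\` N i) `\` \bigcup_j N j)).
  by apply: bigcupT_measurable => i; exact: measurableD.
apply/seteqP; split => [x [Ax Nx]|x [i _ [[[Ax _] _] ?]]]; last by split.
have [i _ Fx] : (\bigcup_i F i) x by rewrite -UF.
by exists i => //; do !split => //; move=> Nix; apply: Nx; exists i.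
Qed.

Lemma completion_measurable_fun (D : set T) d' (U : measurableType d') (f : T -> U) :
  measurable D -> measurable_fun D f -> @measurable_fun _ _ cT U D f.
Proof. by move=> mD mf _ B mB; apply: completion_measurable; exact: mf. Qed.

(* The rational superlevel sets suffice to test measurability, so countably many
   exceptional null sets are removed. *)
Lemma completion_measurable_fun_null (f : T -> R) :
  @measurable_fun _ _ cT _ setT f ->
  exists N, [/\ measurable N, mu N = 0 & measurable_fun (~` N) f].
Proof.
(* [q] enumerates the rationals; an index that decodes to none gets the default level 0, which is
   only a repetition. *)
move=> mf; pose q k : R := ratr (odflt 0%R (unpickle k)).
have level k : exists N, [/\ measurable N, mu N = 0 &
    measurable (f @^-1` `]q k, +oo[ `\` N)].
  by apply: completion_setD_null; rewrite -[X in measurable X]setTI; exact: mf.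
pose N k := projT1 (cid (level k)).
have mN k : measurable (N k) by rewrite /N; case: cid => ? [].
have N0 k : mu (N k) = 0 by rewrite /N; case: cid => ? [].
have mfN k : measurable (f @^-1` `]q k, +oo[ `\` N k).
  by rewrite /N; case: cid => ? [].
have mUN : measurable (\bigcup_i N i) by exact: bigcupT_measurable.
exists (\bigcup_i N i); split => //.
  apply/(negligibleP mu mUN)/negligible_bigcup => i.
  by exists (N i); split; [exact: mN|exact: N0|].
apply: (measurability _ (RGenOInfty.measurableE R)) => _ [_ [x ->] <-].
rewrite (_ : _ `&` _ = \bigcup_(k in [set k | (x < q k)%R])
    ((f @^-1` `]q k, +oo[ `\` N k) `\` \bigcup_i N i)).
  by apply: bigcup_measurable => k _; exact: measurableD.
apply/seteqP; split => [y [Ny /=]|y [k /= xk [[/= fy _] Ny]]].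
  rewrite in_itv/= andbT => xf.
  have [r] := rat_in_itvoo xf; rewrite in_itv/= => /andP[xr rf].
  exists (pickle r); first by rewrite /= /q pickleK.
  split => //; split => /=; first by rewrite in_itv/= andbT /q pickleK.
  by move=> Nr; apply: Ny; exists (pickle r).
split => //=; move: fy; rewrite !in_itv/= !andbT; exact: lt_trans.
Qed.

(** The identity map from the completed to the original sigma-algebra is measurable and pushes the
    completed measure forward to [mu]. *)
Lemma completion_ge0_integral (D : set T) (f : T -> \bar R) :
  measurable D -> measurable_fun D f -> (forall x, D x -> 0 <= f x) ->
  \int[cmu]_(x in D) f x = \int[mu]_(x in D) f x.
Proof.
move=> mD mf f0.
have mid : @measurable_fun _ _ cT T setT (id : cT -> T).
  by move=> _ B mB; rewrite setTI; exact: completion_measurable.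
have := @ge0_integral_pushforward _ _ cT T R (id : cT -> T) mid cmu D f mD mf.
move=> <-; last by move=> x; rewrite inE; exact: f0.
by apply: eq_measure_integral => A mA _; rewrite /pushforward; exact: completion_measureE.
Qed.

End completion.

(** * Lebesgue measure under dilations *)

Section dilation.
Local Open Scope ereal_scope.
Context (R : realType).
Local Notation leb := (@lebesgue_measure R).
Local Notation T n := (n.-tuple (measurableTypeR R)).
Local Notation mu n := (borel_lebesgue R n).

Lemma integral_borel_lebesgueS n (f : T n.+1 -> \bar R) :
  measurable_fun setT f -> (forall z, 0 <= f z) ->
  \int[mu n.+1]_z f z = \int[leb]_x \int[mu n]_t f (tcons (x, t)).
Proof.
move=> mf f0.
have mtc := @measurable_tcons _ (measurableTypeR R) n.
have -> : \int[mu n.+1]_z f z =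
  \int[pushforward (leb \x mu n) (@tcons _ (measurableTypeR R) n)]_z f z by [].
rewrite (ge0_integral_pushforward mtc)//= preimage_setT.
by rewrite fubini_tonelli1//; exact: measurableT_comp.
Qed.

(** The measure [nu], which is a times the pushforward under multiplication by a, gives every
    half-open interval its length, so it is Lebesgue measure by uniqueness. *)
Lemma ge0_integral_scale (a : R) (f : measurableTypeR R -> \bar R) : (0 < a)%R ->
  measurable_fun setT f -> (forall x, 0 <= f x) ->
  a%:E * \int[leb]_x f (a * x)%R = \int[leb]_x f x.
Proof.
move=> a0 mf f0.
have ma : measurable_fun [set: measurableTypeR R]
    (( *%R a) : measurableTypeR R -> measurableTypeR R).
  exact: mulrl_measurable.
pose nu := mscale (NngNum (ltW a0)) (pushforward leb
  (( *%R a) : measurableTypeR R -> measurableTypeR R)).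
have lebnu A : measurable A -> leb A = nu ma A.
  apply: lebesgue_measure_unique => X [[u v] _ <-].
  transitivity (a%:E * leb `](a^-1 * u)%R, (a^-1 * v)%R]%classic); last first.
    congr (_ * leb _).
    apply/seteqP; split => x /=; rewrite !in_itv/=.
      by rewrite ltr_pdivrMl// ler_pdivlMl.
    by rewrite ltr_pdivrMl// ler_pdivlMl.
  rewrite !lebesgue_measure_itv/= !lte_fin ltr_pM2l ?invr_gt0//.
  case: ifPn => _; last by rewrite mule0.
  by rewrite -!EFinB -EFinM -mulrBr mulVKf// gt_eqF.
rewrite [RHS](eq_measure_integral (nu ma)); last by move=> A mA _; exact: lebnu.
rewrite ge0_integral_mscale//; congr (_ * _); apply/esym.
by rewrite -[RHS](ge0_integral_pushforward ma leb measurableT mf).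
Qed.

(** This is [dilate] retyped on the Borel space, so that measurability refers to the Borel
    sigma-algebra and not to the completed one. *)
Definition dilation n (a : R) : T n -> T n := @dilate R n a.

Lemma tnth_dilation n a (x : T n) i : tnth (dilation a x) i = (a * tnth x i)%R.
Proof. by rewrite tnth_mktuple. Qed.

Lemma dilation_tcons n a x (t : T n) :
  dilation a (tcons (x, t)) = tcons ((a * x)%R : measurableTypeR R, dilation a t).
Proof.
apply: eq_from_tnth => i; rewrite tnth_dilation.
case: (unliftP ord0 i) => [j|] ->; last by rewrite !tnth0.
by rewrite !tnthS tnth_dilation.
Qed.

(** Joint measurability in (x, t) is what later allows Tonelli's theorem for integrands built from
    g_i(t_i x). *)
Lemma measurable_dilation_pair n m (i : 'I_m) :
  measurable_fun setT (fun xt : T n * T m => dilation (tnth xt.2 i) xt.1).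
Proof.
apply/measurable_fun_tnthP => j.
rewrite (_ : _ \o _ = fun xt => (tnth xt.2 i * tnth xt.1 j)%R); last first.
  by apply/funext => xt /=; rewrite tnth_dilation.
by apply: measurable_funM;
  apply: (measurableT_comp (@measurable_tnth _ (measurableTypeR R) _ _)).
Qed.

Lemma measurable_dilation n a : measurable_fun setT (@dilation n a).
Proof.
apply/measurable_fun_tnthP => j.
rewrite (_ : _ \o _ = fun x => (a * tnth x j)%R); last first.
  by apply/funext => x /=; rewrite tnth_dilation.
by apply: measurable_funM => //; exact: (@measurable_tnth _ (measurableTypeR R)).
Qed.

(** Induction on the dimension: one factor a comes from the first coordinate, the others from the
    remaining tuple. *)
Lemma ge0_integral_dilation n (a : R) (f : T n -> \bar R) : (0 < a)%R ->
  measurable_fun setT f -> (forall x, 0 <= f x) ->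
  (a ^+ n)%:E * \int[mu n]_x f (dilation a x) = \int[mu n]_x f x.
Proof.
move=> a0; elim: n f => [|n IHn] f mf f0.
  rewrite expr0 mul1e; apply: eq_integral => x _; congr f.
  by rewrite (tuple0 x) (tuple0 (dilation a _)).
have mfa : measurable_fun setT (f \o dilation a).
  by apply: measurableT_comp => //; exact: measurable_dilation.
have mt g : measurable_fun setT g -> measurable_fun setT
    (g \o (tcons (n:=n) : measurableTypeR R * T n -> T n.+1) : _ -> \bar R).
  by move=> mg; apply: measurableT_comp => //; exact: measurable_tcons.
have mft := mt _ mf.
have mftx x : measurable_fun setT (fun t : T n => f (tcons (x, t))).
  exact: (measurableT_comp mft).
rewrite !integral_borel_lebesgueS//.
rewrite -(@ge0_integral_scale a (fun x => \int[mu n]_t f (tcons (x, t))))//.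
- rewrite exprS EFinM -muleA; congr (_ * _).
  rewrite -ge0_integralZl//.
  + apply: eq_integral => x _; rewrite -(IHn (fun t => f (tcons (_, t))))//.
    by congr (_ * _); apply: eq_integral => t _; rewrite dilation_tcons.
  + exact: (@measurable_fun_fubini_tonelli_F _ _ _ _ R (mu n) _ (mt _ mfa) (fun=> f0 _)).
  + by move=> x _; exact: integral_ge0.
  + by rewrite lee_fin exprn_ge0// ltW.
- exact: (@measurable_fun_fubini_tonelli_F _ _ _ _ R (mu n) _ mft (fun=> f0 _)).
- by move=> x; exact: integral_ge0.
Qed.

Lemma borel_lebesgue_box n :
  mu n [set x | forall i, `|tnth x i| <= 1]%R = (2 ^+ n)%:E.
Proof.
elim: n => [|n IHn].
  rewrite /= diracE expr0 mem_set//= => -[]//.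
set B := [set x | _] in IHn.
have mB : measurable B.
  rewrite (_ : B = \bigcap_(i in [set: 'I_n]) (fun x => tnth x i) @^-1` `[(-1)%R, 1%R]%classic).
    apply: fin_bigcap_measurable => // i _.
    by rewrite -[X in measurable X]setTI; apply: (@measurable_tnth _ (measurableTypeR R)).
  apply/seteqP; split => x.
    by move=> Bx i _ /=; rewrite in_itv/= -ler_norml.
  by move=> Bx i; have := Bx i I; rewrite /= in_itv/= -ler_norml.
have leb11 : leb `[(-1)%R, 1%R]%classic = 2%:E.
  rewrite lebesgue_measure_itv/= lte_fin ifT; last by lra.
  by rewrite -EFinB; congr (_%:E); lra.
rewrite /= /power_step /pushforward.
rewrite (_ : _ @^-1` _ = (`[(-1)%R, 1%R]%classic : set (measurableTypeR R)) `*` B).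
  rewrite product_measure1E// IHn exprS EFinM; congr (_ * _).
  exact: leb11.
apply/seteqP; split => -[x t] /=.
  move=> H; split; first by have := H ord0; rewrite tnth0 in_itv/= -ler_norml.
  by move=> i; have := H (lift ord0 i); rewrite tnthS.
rewrite in_itv/= -ler_norml => -[x1 Bt] i.
by case: (unliftP ord0 i) => [j|] ->; rewrite ?tnth0 ?tnthS//; exact: Bt.
Qed.

End dilation.

(** * Hoelder's inequality for several functions *)

Section hoelder_family.
Context (R : realType).

Lemma powR_prod (I : Type) (r : seq I) (F : I -> R) (p : R) :
  (forall i, 0 <= F i) -> (\prod_(i <- r) F i) `^ p = \prod_(i <- r) F i `^ p.
Proof.
move=> F0; elim: r => [|i r IHr]; first by rewrite !big_nil powR1.
by rewrite !big_cons powRM ?IHr ?prodr_ge0.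
Qed.

Lemma powR_sum (I : Type) (r : seq I) (l : I -> R) (x : R) : x != 0 ->
  \prod_(i <- r) x `^ l i = x `^ (\sum_(i <- r) l i).
Proof.
move=> x0; elim/big_rec2: _ => [|i u v _ ->]; first by rewrite powRr0.
by rewrite powRD// x0 implybT.
Qed.

(** After division by the weighted mean [s] the product is at most the exponential of the sum of l_i
    (y_i / s - 1), and this sum is 0 because the weights add up to 1. *)
Lemma weighted_amgm m (l y : 'I_m -> R) : (forall i, 0 < l i) ->
  (forall i, 0 <= y i) -> \sum_(i < m) l i = 1 ->
  \prod_(i < m) y i `^ l i <= \sum_(i < m) l i * y i.
Proof.
move=> l0 y0 l1; set s := \sum_(i < m) l i * y i.
have s_ge0 : 0 <= s by apply: sumr_ge0 => i _; rewrite mulr_ge0// ltW.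
have [s0|s_neq0] := eqVneq s 0.
  (* If the mean vanishes then so does y_0, hence the product; m = 0 is impossible since an empty
     sum of weights is not 1. *)
  case: m l y l0 y0 l1 @s s_ge0 s0 => [|m] l y l0 y0 l1 s s_ge0 s0.
    by move/eqP: l1; rewrite [X in X == _]big_ord0 eq_sym oner_eq0.
  rewrite s0 big_ord_recl (_ : y ord0 = 0) ?powR0 ?mul0r ?gt_eqF//.
  move/eqP: s0; rewrite psumr_eq0 => [/allP/(_ ord0)|i _].
    by rewrite mem_index_enum mulf_eq0 gt_eqF//= => /(_ isT)/eqP.
  by rewrite mulr_ge0// ltW.
have s_gt0 : 0 < s by rewrite lt_def s_neq0.
have -> : \prod_(i < m) y i `^ l i = s * \prod_(i < m) (y i / s) `^ l i.
  under [in RHS]eq_bigr do rewrite powRM ?invr_ge0//.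
  rewrite big_split/= mulrCA (_ : s * _ = 1) ?mulr1//.
  rewrite powR_sum ?invr_eq0//.
  by rewrite l1 powRr1 ?invr_ge0// divff.
(* y <= exp (y - 1) *)
rewrite -[leRHS]mulr1 ler_pM2l//.
apply: (@le_trans _ _ (\prod_(i < m) expR (l i * (y i / s - 1)))).
  apply: ler_prod => i _; rewrite powR_ge0/= [X in expR X]mulrC expRM.
  apply: ge0_ler_powR; rewrite ?nnegrE ?divr_ge0 ?expR_ge0//; first exact: ltW.
  by have := expR_ge1Dx (y i / s - 1); rewrite addrC subrK.
rewrite -expR_sum -[leRHS]expR0 ler_expR.
under eq_bigr do rewrite mulrBr mulr1 mulrA.
by rewrite sumrB l1 -mulr_suml divff// subrr.
Qed.

Local Open Scope ereal_scope.
Context d (T : measurableType d).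
Variable mu : {measure set T -> \bar R}.

(** The numbers p / p_i are weights of total 1, so the inequality between means applies pointwise to
    the normalised functions h_i^(p_i) / a_i. Each of these has integral 1, and integration leaves
    the sum of the weights. *)
Lemma hoelder_family m (p : R) (ps : 'I_m -> R) (h : 'I_m -> T -> R)
    (a : 'I_m -> R) :
  (0 < p)%R -> (forall i, 0 < ps i)%R -> (p^-1 = \sum_(i < m) (ps i)^-1)%R ->
  (forall i, measurable_fun setT (h i)) -> (forall i x, 0 <= h i x)%R ->
  (forall i, \int[mu]_x (h i x `^ ps i)%:E = (a i)%:E) ->
  \int[mu]_x ((\prod_(i < m) h i x) `^ p)%:E <=
    (\prod_(i < m) a i `^ (p / ps i))%:E.
Proof.
move=> p0 ps0 pps mh h0 ha.
have mhp i : measurable_fun setT (fun x => h i x `^ ps i)%R.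
  exact: (measurableT_comp (measurable_powR _)).
have mprod : measurable_fun setT (fun x => (\prod_(i < m) h i x) `^ p)%R.
  apply: (measurableT_comp (measurable_powR _)).
  exact: measurable_prod.
have a0 i : (0 <= a i)%R.
  by rewrite -lee_fin -ha; apply: integral_ge0 => x _; rewrite lee_fin powR_ge0.
(* Normalisation divides by a_i; if some a_i is 0, then h_i vanishes almost everywhere and the left
   side is 0. *)
have [[i ai0]|/forallNP a_neq0] := pselect (exists i, a i = 0%R).
  have : ae_eq mu setT (fun x => (h i x `^ ps i)%:E) (cst 0).
    apply/ae_eq_integral_abs => //; first exact/measurable_EFinP.
    rewrite -[RHS]/(0%R%:E) -ai0 -ha; apply: eq_integral => x _.
    by rewrite /= ger0_norm// powR_ge0.
  move=> hi0; rewrite (@ge0_ae_eq_integral _ _ _ mu setT _ (cst 0))//.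
  - rewrite integral0 lee_fin; apply: prodr_ge0 => j _; exact: powR_ge0.
  - exact/measurable_EFinP.
  - by move=> x _; rewrite lee_fin powR_ge0.
  - apply: filterS hi0 => x /(_ I) [] /eqP; rewrite powR_eq0 => /andP[/eqP hx _] _.
    by rewrite (bigD1 i)//= hx mul0r powR0// gt_eqF.
have a_gt0 i : (0 < a i)%R by rewrite lt_def a0 andbT; apply/eqP/a_neq0.
pose l i := (p / ps i)%R.
have l0 i : (0 < l i)%R by rewrite divr_gt0.
have l1 : (\sum_(i < m) l i = 1)%R by rewrite -mulr_sumr -pps divff// gt_eqF.
set c := (\prod_(i < m) _)%R.
have c0 : (0 <= c)%R by apply: prodr_ge0 => j _; exact: powR_ge0.
have pointwise x : (((\prod_(i < m) h i x) `^ p) <=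
    c * \sum_(i < m) l i * ((a i)^-1 * h i x `^ ps i))%R.
  rewrite powR_prod//.
  have -> : (\prod_(i < m) h i x `^ p =
      c * \prod_(i < m) ((a i)^-1 * h i x `^ ps i) `^ l i)%R.
    rewrite -big_split/=; apply: eq_bigr => i _.
    rewrite -powRM ?mulr_ge0 ?invr_ge0 ?powR_ge0// mulVKf ?gt_eqF//.
    by rewrite -powRrM /l mulrCA divff ?mulr1// gt_eqF.
  apply: ler_wpM2l => //; apply: weighted_amgm => // i.
  by rewrite mulr_ge0 ?invr_ge0 ?powR_ge0.
apply: (@le_trans _ _
    (\int[mu]_x (c%:E * \sum_(i < m) (l i / a i)%:E * (h i x `^ ps i)%:E))).
  apply: ge0_le_integral => //.
  - by move=> x _; rewrite lee_fin powR_ge0.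
  - exact/measurable_EFinP.
  - apply: measurable_funeM; apply: emeasurable_sum => i.
    by apply: measurable_funeM; exact/measurable_EFinP.
  - move=> x _; rewrite (eq_bigr (fun i => (l i / a i * h i x `^ ps i)%:E))//.
    rewrite sumEFin -EFinM lee_fin (le_trans (pointwise x))// ler_wpM2l//.
    by rewrite le_eqVlt; apply/orP; left; apply/eqP/eq_bigr => i _; rewrite mulrA.
rewrite ge0_integralZl//; last 2 first.
  - apply: emeasurable_sum => i.
    by apply: measurable_funeM; exact/measurable_EFinP.
  - move=> x _; apply: sume_ge0 => i _.
    by rewrite mule_ge0// lee_fin ?powR_ge0 ?divr_ge0// ltW.
rewrite ge0_integral_sum//; last 2 first.
  - by move=> i; apply: measurable_funeM; exact/measurable_EFinP.
  - by move=> i x _; rewrite mule_ge0// lee_fin ?powR_ge0 ?divr_ge0// ltW.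
rewrite (eq_bigr (fun i => (l i)%:E)).
  by rewrite sumEFin l1 mule1.
move=> i _; rewrite ge0_integralZl//.
- by rewrite ha -EFinM divfK// gt_eqF.
- exact/measurable_EFinP.
- by move=> x _; rewrite lee_fin powR_ge0.
- by rewrite lee_fin divr_ge0// ltW.
Qed.

(** Hoelder's inequality with conjugate exponents p and q for the factorisation u v = (u v^(1/p))
    v^(1/q), raised to the power p; the exponent of A is p/q = p - 1. *)
Lemma powR_integral_le (p A : R) (u v : T -> R) : (1 < p)%R ->
  measurable_fun setT u -> measurable_fun setT v ->
  (forall x, 0 <= u x)%R -> (forall x, 0 <= v x)%R ->
  \int[mu]_x (v x)%:E = A%:E ->
  (\int[mu]_x (u x * v x)%:E) `^ p <=
    (A `^ (p - 1))%:E * \int[mu]_x (u x `^ p * v x)%:E.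
Proof.
move=> p1 mu_ mv u0 v0 vA.
have p0 : (0 < p)%R by apply: lt_trans p1.
have p10 : (0 < p - 1)%R by rewrite subr_gt0.
pose q := (p / (p - 1))%R.
have q0 : (0 < q)%R by rewrite divr_gt0.
have pq : (p^-1 + q^-1 = 1)%R by rewrite /q invf_div; field; rewrite gt_eqF.
have A0 : (0 <= A)%R.
  by rewrite -lee_fin -vA; apply: integral_ge0 => x _; rewrite lee_fin.
have mup : measurable_fun setT (fun x => u x `^ p * v x)%R.
  by apply: measurable_funM => //; exact: (measurableT_comp (measurable_powR _)).
have mf : measurable_fun setT (fun x => u x * v x `^ p^-1)%R.
  by apply: measurable_funM => //; exact: (measurableT_comp (measurable_powR _)).
have mg : measurable_fun setT (fun x => v x `^ q^-1)%R.
  exact: (measurableT_comp (measurable_powR _)).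
have := hoelder mu mf mg p0 q0 pq.
rewrite Lnorm1 (_ : \int[mu]_x _ = \int[mu]_x (u x * v x)%:E); last first.
  apply: eq_integral => x _ /=; rewrite -mulrA -powRD; last first.
    by rewrite pq oner_eq0.
  by rewrite pq powRr1// ger0_norm// mulr_ge0.
rewrite unlock /= (_ : \int[mu]_x (`|_| `^ p)%:E = \int[mu]_x (u x `^ p * v x)%:E); last first.
  apply: eq_integral => x _; rewrite /= ger0_norm ?mulr_ge0 ?powR_ge0//.
  by rewrite powRM ?powR_ge0// -powRrM mulVf ?powRr1// gt_eqF.
rewrite (_ : \int[mu]_x (`|_| `^ q)%:E = \int[mu]_x (v x)%:E); last first.
  apply: eq_integral => x _; rewrite /= ger0_norm ?powR_ge0//.
  by rewrite -powRrM mulVf ?powRr1// gt_eqF.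
rewrite vA => le.
have uv0 : 0 <= \int[mu]_x (u x * v x)%:E.
  by apply: integral_ge0 => x _; rewrite lee_fin mulr_ge0.
have I0 : 0 <= \int[mu]_x (u x `^ p * v x)%:E.
  by apply: integral_ge0 => x _; rewrite lee_fin mulr_ge0// powR_ge0.
have := gt0_ler_poweR (ltW p0) _ _ le.
rewrite !in_itv/= !leey !andbT uv0 mule_ge0 ?poweR_ge0 ?lee_fin ?powR_ge0// => /(_ isT isT)/le_trans; apply.
rewrite -poweR_EFin poweRM ?poweR_ge0// -!poweRrM mulVf ?gt_eqF// poweRe1// muleC.
by rewrite poweR_EFin (_ : q^-1 * p = p - 1)%R// /q invf_div divfK// gt_eqF.
Qed.

End hoelder_family.

(** * The upper estimate for Borel functions *)

Section hardy_upper.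
Local Open Scope ereal_scope.
Context (R : realType) (n m : nat).
Local Notation T n := (n.-tuple (measurableTypeR R)).
Local Notation mu n := (borel_lebesgue R n).

Definition dilation_prod (g : 'I_m -> T n -> R) (xt : T n * T m) : R :=
  (\prod_(i < m) g i (dilation (tnth xt.2 i) xt.1))%R.

Lemma dilation_prod_ge0 g xt : (forall i x, 0 <= g i x)%R ->
  (0 <= dilation_prod g xt)%R.
Proof. by move=> g0; apply: prodr_ge0 => i _. Qed.

Lemma measurable_dilation_prod (g : 'I_m -> T n -> R) :
  (forall i, measurable_fun setT (g i)) -> measurable_fun setT (dilation_prod g).
Proof.
move=> mg; apply: measurable_prod => i _.
by apply: measurableT_comp => //; exact: measurable_dilation_pair.
Qed.

(** The double integral is zero in one order, hence in the other, and a nonnegative function with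
    zero integral vanishes almost everywhere. *)
Lemma ae_tonelli (f : T n * T m -> \bar R) : measurable_fun setT f ->
  (forall z, 0 <= f z) -> (forall t, \int[mu n]_x f (x, t) = 0) ->
  {ae mu n, forall x, {ae mu m, forall t, f (x, t) = 0}}.
Proof.
move=> mf f0 fx0.
have mF : measurable_fun setT (fun x => \int[mu m]_t f (x, t)).
  exact: (measurable_fun_fubini_tonelli_F _ mf f0).
have : \int[mu n]_x \int[mu m]_t f (x, t) = 0.
  by rewrite fubini_tonelli//; apply: integral0_eq.
move=> I0.
have : ae_eq (mu n) setT (fun x => \int[mu m]_t f (x, t)) (cst 0).
  apply/ae_eq_integral_abs => //; rewrite -[RHS]I0; apply: eq_integral => x _.
  by rewrite gee0_abs//; exact: integral_ge0.
apply: filterS => x /(_ I) /= Ix.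
have : ae_eq (mu m) setT (fun t => f (x, t)) (cst 0).
  apply/ae_eq_integral_abs => //; first exact: (measurableT_comp mf).
  by rewrite -[RHS]Ix; apply: eq_integral => t _; rewrite gee0_abs.
by apply: filterS => t /(_ I).
Qed.

(** This makes the operator insensitive to changing f_i on a null set: for fixed t with t_i > 0 the
    points x with t_i x in N form a null set by scaling, and Tonelli exchanges the roles of x and
    t. *)
Lemma ae_dilation_notin (N : set (T n)) (i : 'I_m) :
  measurable N -> mu n N = 0 ->
  {ae mu n, forall x, {ae mu m, forall t,
    (0 < tnth t i)%R -> ~ N (dilation (tnth t i) x)}}.
Proof.
move=> mN N0.
(* At t_i = 0 the dilate is the origin whatever x is, and the origin may lie in N; such t must be
   left out. *)
pose P := [set t : T m | (0 < tnth t i)%R].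
have mP : measurable P.
  rewrite (_ : P = (fun t => tnth t i) @^-1` `]0%R, +oo[%classic).
    by rewrite -[X in measurable X]setTI; apply: (@measurable_tnth _ (measurableTypeR R)).
  by apply/seteqP; split => t /=; rewrite in_itv/= andbT.
pose f (xt : T n * T m) : \bar R :=
  (\1_P xt.2 * \1_N (dilation (tnth xt.2 i) xt.1) : R)%:E.
have mf : measurable_fun setT f.
  apply/measurable_EFinP; apply: measurable_funM.
    by apply: (measurableT_comp (measurable_indic _)).
  apply: (measurableT_comp (measurable_indic _)) => //.
  exact: measurable_dilation_pair.
have f0 z : 0 <= f z by rewrite lee_fin mulr_ge0.
have := ae_tonelli mf f0; have fx0 t : \int[mu n]_x f (x, t) = 0.
  have [tP|tP] := pselect (P t); last first.
    by apply: integral0_eq => x _; rewrite /f/= indicE memNset// mul0r.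
  have : (tnth t i ^+ n)%:E * \int[mu n]_x (\1_N (dilation (tnth t i) x) : R)%:E = 0.
    rewrite (@ge0_integral_dilation _ n _ (fun x => (\1_N x : R)%:E))//.
      by rewrite integral_indic// setIT.
    exact/measurable_EFinP.
  move=> /eqP; rewrite mule_eq0 eqe expf_eq0 gt_eqF// andbF/= => /eqP <-.
  by apply: eq_integral => x _; rewrite /f/= indicE mem_set// mul1r.
move=> /(_ fx0); apply: filterS => x; apply: filterS => t + t0 Nx.
by rewrite /f/= !indicE !mem_set// mul1r => -[] /eqP; rewrite oner_eq0.
Qed.

Variables (p : R) (ps : 'I_m -> R).
Hypotheses (p1 : (1 < p)%R) (ps1 : forall i, (1 < ps i)%R).
Hypothesis pps : (p^-1 = \sum_(i < m) (ps i)^-1)%R.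

Let p0 : (0 < p)%R. Proof. exact: lt_trans p1. Qed.
Let ps0 i : (0 < ps i)%R. Proof. exact: lt_trans (ps1 i). Qed.

Definition hardy_weight (t : T m) : R :=
  (\prod_(i < m) tnth t i `^ (- (n%:R / ps i)))%R.

Lemma hardy_weight_ge0 t : (0 <= hardy_weight t)%R.
Proof. by apply: prodr_ge0 => i _; exact: powR_ge0. Qed.

Lemma hardy_weight_gt0 t : (forall i, 0 < tnth t i)%R -> (0 < hardy_weight t)%R.
Proof. by move=> t0; apply: prodr_gt0 => i _; exact: powR_gt0. Qed.

Lemma measurable_hardy_weight : measurable_fun setT hardy_weight.
Proof.
apply: measurable_prod => i _; apply: (measurableT_comp (measurable_powR _)).
exact: (@measurable_tnth _ (measurableTypeR R)).
Qed.

Lemma dilation_prod_integral_le (g : 'I_m -> T n -> R) (a : 'I_m -> R) (t : T m) :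
  (forall i, measurable_fun setT (g i)) -> (forall i x, 0 <= g i x)%R ->
  (forall i, \int[mu n]_x (g i x `^ ps i)%:E = (a i)%:E) ->
  (forall i, 0 < tnth t i)%R ->
  \int[mu n]_x (dilation_prod g (x, t) `^ p)%:E <=
    (hardy_weight t `^ p * \prod_(i < m) a i `^ (p / ps i))%:E.
Proof.
move=> mg g0 ga t0.
have a0 i : (0 <= a i)%R.
  by rewrite -lee_fin -ga; apply: integral_ge0 => x _; rewrite lee_fin powR_ge0.
(* The change of variables contributes t_i^(-n); raised to p / p_i this is the p-th power of the
   i-th factor of the weight. *)
pose b i : R := (tnth t i ^- n * a i)%R.
have mgt i : measurable_fun setT (fun x : T n => g i (dilation (tnth t i) x)).
  by apply: measurableT_comp => //; exact: measurable_dilation.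
have gb i : \int[mu n]_x (g i (dilation (tnth t i) x) `^ ps i)%:E = (b i)%:E.
  have tn0 : (tnth t i ^+ n != 0)%R by rewrite expf_neq0// gt_eqF.
  have := @ge0_integral_dilation _ n _ (fun x => (g i x `^ ps i)%:E) (t0 i).
  rewrite ga /b => H; rewrite EFinM -H; last 2 first.
  - by apply/measurable_EFinP; exact: (measurableT_comp (measurable_powR _)).
  - by move=> x; rewrite lee_fin powR_ge0.
  by rewrite muleA -EFinM mulVf// mul1e.
apply: le_trans (hoelder_family p0 ps0 pps mgt _ gb) _ => //.
rewrite lee_fin le_eqVlt; apply/orP; left; apply/eqP.
rewrite [in RHS]powR_prod; last by move=> i; exact: powR_ge0.
rewrite -big_split/=; apply: eq_bigr => i _.
rewrite /b powRM ?invr_ge0 ?exprn_ge0 ?(ltW (t0 i))//; congr (_ * _)%R.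
have -> : (tnth t i ^- n = tnth t i `^ (- n%:R))%R by rewrite powR_invn// ltW.
rewrite -[LHS]powRrM -[RHS]powRrM; congr (_ `^ _)%R.
by rewrite !mulNr mulrA mulrAC.
Qed.

Lemma hardy_borel_le (g : 'I_m -> T n -> R) (w : T m -> R) (a : 'I_m -> R) (A : R) :
  (forall i, measurable_fun setT (g i)) -> (forall i x, 0 <= g i x)%R ->
  measurable_fun setT w -> (forall t, 0 <= w t)%R ->
  (forall t, w t != 0 -> forall i, 0 < tnth t i)%R ->
  (forall i, \int[mu n]_x (g i x `^ ps i)%:E = (a i)%:E) ->
  \int[mu m]_t (hardy_weight t * w t)%:E = A%:E ->
  \int[mu n]_x (\int[mu m]_t (dilation_prod g (x, t) * w t)%:E) `^ p <=
    ((A * \prod_(i < m) a i `^ (ps i)^-1) `^ p)%:E.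
Proof.
move=> mg g0 mw w0 wt ga wA.
have a0 i : (0 <= a i)%R.
  by rewrite -lee_fin -ga; apply: integral_ge0 => x _; rewrite lee_fin powR_ge0.
pose v t : R := (hardy_weight t * w t)%R.
pose u (xt : T n * T m) : R := (dilation_prod g xt * (hardy_weight xt.2)^-1)%R.
have mv : measurable_fun setT v.
  by apply: measurable_funM => //; exact: measurable_hardy_weight.
have v0 t : (0 <= v t)%R by rewrite mulr_ge0// hardy_weight_ge0.
have A0 : (0 <= A)%R.
  by rewrite -lee_fin -wA; apply: integral_ge0 => t _; rewrite lee_fin; exact: v0.
have mF := measurable_dilation_prod mg.
have mu_ : measurable_fun setT u.
  apply: measurable_funM => //.
  rewrite (_ : (fun=> _) = fun xt => (hardy_weight xt.2 `^ (- 1))%R); last first.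
    by apply/funext => xt; rewrite powR_inv1// hardy_weight_ge0.
  apply: (measurableT_comp (measurable_powR _)).
  by apply: measurableT_comp => //; exact: measurable_hardy_weight.
have u0 xt : (0 <= u xt)%R.
  by rewrite mulr_ge0 ?dilation_prod_ge0 ?invr_ge0 ?hardy_weight_ge0.
(* Dividing by the weight is legitimate only where all t_i > 0; elsewhere [w] is zero and both sides
   vanish. *)
have uv x t : (dilation_prod g (x, t) * w t = u (x, t) * v t)%R.
  have [wt0|wt0] := eqVneq (w t) 0%R; first by rewrite /v wt0 !mulr0.
  rewrite /u /v mulrA divfK// gt_eqF// hardy_weight_gt0//; exact: wt.
have muv : measurable_fun setT (fun xt : T n * T m => (u xt `^ p * v xt.2)%:E).
  apply/measurable_EFinP; apply: measurable_funM.
    exact: (measurableT_comp (measurable_powR _)).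
  exact: measurableT_comp.
have uv0 xt : 0 <= (u xt `^ p * v xt.2)%:E by rewrite lee_fin mulr_ge0// powR_ge0.
apply: (@le_trans _ _ (\int[mu n]_x ((A `^ (p - 1))%:E *
    \int[mu m]_t (u (x, t) `^ p * v t)%:E))).
  apply: ge0_le_integral => //.
  - by move=> x _; exact: poweR_ge0.
  - apply: (measurableT_comp (measurable_poweR _)).
    apply: (measurable_fun_fubini_tonelli_F
      (fun xt : T n * T m => (dilation_prod g xt * w xt.2)%:E)).
      apply/measurable_EFinP; apply: measurable_funM => //.
      exact: measurableT_comp.
    by move=> xt; rewrite lee_fin mulr_ge0// dilation_prod_ge0.
  - apply: measurable_funeM.
    exact: (measurable_fun_fubini_tonelli_F _ muv uv0).
  - move=> x _; under eq_integral do rewrite uv.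
    by apply: powR_integral_le => //; exact: (measurableT_comp mu_).
rewrite ge0_integralZl//; last 3 first.
- exact: (measurable_fun_fubini_tonelli_F _ muv uv0).
- by move=> x _; apply: integral_ge0 => t _; exact: (uv0 (x, t)).
- by rewrite lee_fin powR_ge0.
rewrite (fubini_tonelli _ muv uv0).
set B := (\prod_(i < m) a i `^ (p / ps i))%R.
have B0 : (0 <= B)%R by apply: prodr_ge0 => i _; exact: powR_ge0.
(* A^p is split into A^(p-1), which comes from Hoelder's inequality in t, and one more A, which
   comes from integrating [v] over t below. *)
have -> : ((A * \prod_(i < m) a i `^ (ps i)^-1) `^ p = A `^ (p - 1) * (B * A))%R.
  rewrite powRM ?prodr_ge0//; last by move=> *; exact: powR_ge0.
  rewrite powR_prod; last by move=> i; exact: powR_ge0.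
  rewrite -(mulr_powRB1 A0 p0) (eq_bigr (fun i => a i `^ (p / ps i)))%R; last first.
    by move=> i _; rewrite -powRrM mulrC.
  by rewrite -/B; ring.
rewrite EFinM; apply: lee_wpmul2l; first by rewrite lee_fin powR_ge0.
rewrite EFinM -wA -ge0_integralZl//; last 2 first.
- exact/measurable_EFinP.
- by move=> t _; rewrite lee_fin; exact: v0.
apply: ge0_le_integral => //.
- by move=> t _; apply: integral_ge0 => x _; exact: (uv0 (x, t)).
- exact: (measurable_fun_fubini_tonelli_G _ muv uv0).
- by apply: measurable_funeM; exact/measurable_EFinP.
move=> t _ /=.
have [wt0|wt0] := eqVneq (w t) 0%R.
  rewrite integral0_eq; first by rewrite lee_fin mulr_ge0//; exact: v0.
  by move=> x _; rewrite /v wt0 !mulr0.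
have c0 := hardy_weight_gt0 (wt t wt0).
(* [u] contains the inverse of the weight at t; its p-th power will cancel the p-th power of the
   weight produced by Hoelder's inequality in x. *)
rewrite (_ : (fun _ => _) = fun x => ((hardy_weight t)^-1 `^ p * v t)%:E *
    (dilation_prod g (x, t) `^ p)%:E); last first.
  apply/funext => x; rewrite /u/= powRM ?dilation_prod_ge0 ?invr_ge0 ?ltW//.
  by rewrite -EFinM; congr (_%:E); ring.
rewrite ge0_integralZl//; last 3 first.
- apply/measurable_EFinP; apply: (measurableT_comp (measurable_powR _)).
  exact: (measurableT_comp mF).
- by move=> x _; rewrite lee_fin powR_ge0.
- by rewrite lee_fin mulr_ge0// powR_ge0.
apply: (@le_trans _ _ (((hardy_weight t)^-1 `^ p * v t)%:E *
    (hardy_weight t `^ p * B)%:E)).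
  apply: lee_wpmul2l; first by rewrite lee_fin mulr_ge0// powR_ge0.
  by apply: dilation_prod_integral_le => //; exact: wt.
rewrite -!EFinM lee_fin mulrACA -powRM ?invr_ge0 ?(ltW c0)// mulVf ?gt_eqF//.
by rewrite powR1 mul1r mulrC.
Qed.

End hardy_upper.

(** * Modulus and integral of complex-valued functions *)

Section complex_integrals.
Context d (T : measurableType d) (R : realType).
Variable mu : {measure set T -> \bar R}.
Implicit Types (D : set T) (f g : T -> R[i]).
Local Notation normc := (@ComplexField.Normc.normc R).

Lemma normc_ge0 (z : R[i]) : 0 <= normc z.
Proof. by case: z => a b; exact: sqrtr_ge0. Qed.

Lemma sqr_normcE (z : R[i]) :
  normc z ^+ 2 = complex.Re z ^+ 2 + complex.Im z ^+ 2.
Proof. by case: z => a b /=; rewrite sqr_sqrtr// addr_ge0 ?sqr_ge0. Qed.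

Lemma normr_Re_le (z : R[i]) : `|complex.Re z| <= normc z.
Proof.
by case: z => a b /=; rewrite -sqrtr_sqr ler_wsqrtr// lerDl sqr_ge0.
Qed.

Lemma normr_Im_le (z : R[i]) : `|complex.Im z| <= normc z.
Proof.
by case: z => a b /=; rewrite -sqrtr_sqr ler_wsqrtr// lerDr sqr_ge0.
Qed.

Lemma normc_real (x : R) : normc x%:C%C = `|x|.
Proof. by rewrite /= expr0n/= addr0 sqrtr_sqr. Qed.

Lemma normc_prod (I : Type) (r : seq I) (F : I -> R[i]) :
  normc (\prod_(i <- r) F i) = \prod_(i <- r) normc (F i).
Proof.
elim/big_rec2: _ => [|i a b _ <-]; first exact: ComplexField.Normc.normc1.
exact: ComplexField.Normc.normcM.
Qed.

Lemma cmeasurableM D f g : cmeasurable D f -> cmeasurable D g ->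
  cmeasurable D (fun x => f x * g x).
Proof.
move=> [mfr mfi] [mgr mgi]; split.
- rewrite (_ : _ \o _ = fun x => complex.Re (f x) * complex.Re (g x) -
    complex.Im (f x) * complex.Im (g x)).
    by apply: measurable_funB; exact: measurable_funM.
  by apply/funext => x /=; case: (f x) (g x) => a b [].
- rewrite (_ : _ \o _ = fun x => complex.Re (f x) * complex.Im (g x) +
    complex.Im (f x) * complex.Re (g x)).
    by apply: measurable_funD; exact: measurable_funM.
  by apply/funext => x /=; case: (f x) (g x) => a b [].
Qed.

Lemma cmeasurable_prod D (I : Type) (r : seq I) (F : I -> T -> R[i]) :
  (forall i, cmeasurable D (F i)) -> cmeasurable D (fun x => \prod_(i <- r) F i x).
Proof.
move=> mF; elim: r => [|i r IHr].
  split.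
    by rewrite (_ : _ \o _ = cst 1)//; apply/funext => x /=; rewrite big_nil.
  by rewrite (_ : _ \o _ = cst 0)//; apply/funext => x /=; rewrite big_nil.
rewrite (_ : (fun x => _) = fun x => F i x * \prod_(j <- r) F j x).
  exact: cmeasurableM.
by apply/funext => x; rewrite big_cons.
Qed.

Lemma cmeasurable_real D (w : T -> R) : measurable_fun D w ->
  cmeasurable D (fun x => (w x)%:C%C).
Proof. by move=> mw; split; [exact: mw|exact: measurable_cst]. Qed.

Lemma measurable_normc D f : cmeasurable D f -> measurable_fun D (normc \o f).
Proof.
move=> [mr mi]; rewrite (_ : normc \o f = fun x =>
    (complex.Re (f x) ^+ 2 + complex.Im (f x) ^+ 2) `^ 2^-1); last first.
  apply/funext => x; rewrite powR12_sqrt ?addr_ge0 ?sqr_ge0//=.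
  by case: (f x).
apply: (measurableT_comp (measurable_powR _)).
by apply: measurable_funD; apply: measurable_funX.
Qed.

Lemma normc_cintegrable D f : measurable D -> cmeasurable D f ->
  mu.-integrable D (EFin \o normc \o f) -> cintegrable mu D f.
Proof.
move=> mD [mr mi] fi; split.
- apply: (le_integrable mD) fi; first exact/measurable_EFinP.
  by move=> x _; rewrite lee_fin (le_trans (normr_Re_le _))// ler_norm.
- apply: (le_integrable mD) fi; first exact/measurable_EFinP.
  by move=> x _; rewrite lee_fin (le_trans (normr_Im_le _))// ler_norm.
Qed.

Lemma normc_cintegral_le D f : measurable D -> cmeasurable D f ->
  mu.-integrable D (EFin \o normc \o f) ->
  normc (cintegral mu D f) <= \int[mu]_(x in D) normc (f x).
Proof.
move=> mD mf fi; have [ir ii] := normc_cintegrable mD mf fi.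
set z := cintegral mu D f.
(* |z|^2 is the integral of Re (conj z * f), whose integrand is at most |z| |f| *)
have zE : normc z ^+ 2 = \int[mu]_(x in D)
    (complex.Re z * complex.Re (f x) + complex.Im z * complex.Im (f x)).
  rewrite RintegralD//; last 2 first.
  - exact: (integrableZl mD (complex.Re z) ir).
  - exact: (integrableZl mD (complex.Im z) ii).
  by rewrite !RintegralZl// sqr_normcE !expr2.
have : normc z ^+ 2 <= normc z * \int[mu]_(x in D) normc (f x).
  rewrite zE -RintegralZl//; apply: le_Rintegral => //.
  - apply: (integrableD mD (f := EFin \o (fun x => complex.Re z * complex.Re (f x)))
      (g := EFin \o (fun x => complex.Im z * complex.Im (f x)))).
      exact: (integrableZl mD (complex.Re z) ir).
    exact: (integrableZl mD (complex.Im z) ii).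
  - exact: (integrableZl mD (normc z) fi).
  move=> x _; apply: le_trans (ler_norm _) _.
  rewrite -ler_sqr ?nnegrE ?mulr_ge0 ?normc_ge0// real_normK ?num_real//.
  rewrite exprMn !sqr_normcE -subr_ge0.
  set a := complex.Re z; set b := complex.Im z.
  set u := complex.Re (f x); set v := complex.Im (f x).
  (* Lagrange's identity: the defect in the Cauchy-Schwarz inequality in the plane is a square. *)
  by rewrite (_ : _ - _ = (a * v - b * u) ^+ 2) ?sqr_ge0//; ring.
have [->|z0] := eqVneq (normc z) 0.
  by move=> _; apply: Rintegral_ge0 => // x _; exact: normc_ge0.
by rewrite expr2 ler_pM2l// lt_def z0 normc_ge0.
Qed.

End complex_integrals.

(** * Borel versions of functions measurable for the completion *)

Section completion_functions.
Local Open Scope ereal_scope.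
Context d (T : measurableType d) (R : realType).
Variable mu : {sigma_finite_measure set T -> \bar R}.

Let cT : measurableType _ := caratheodory_type (mu^*)%mu.
Let cmu : {measure set cT -> \bar R} := @completed_measure_extension _ _ _ mu.

Lemma completion_ae (P : T -> Prop) :
  {ae cmu, forall x, P x} <-> {ae mu, forall x, P x}.
Proof. by split; [exact: completion_negligible|exact: negligible_completion]. Qed.

(** The value 0 on [N] is recorded so that the sign and the support of f carry over to g. *)
Lemma completion_borel_version (f : T -> R) :
  @measurable_fun _ _ cT _ setT f ->
  exists (N : set T) (g : T -> R), [/\ measurable N, mu N = 0, measurable_fun setT g,
    forall x, N x -> g x = 0%R & forall x, ~ N x -> g x = f x].
Proof.
move=> /completion_measurable_fun_null[N [mN N0 mf]].
exists N, (f \_ (~` N)); split => //.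
- by apply/measurable_restrict => //; [exact: measurableC|rewrite setTI].
- by move=> x Nx; rewrite patchE memNset//; apply.
- by move=> x Nx; rewrite patchE mem_set.
Qed.

Lemma completion_borel_cversion (f : T -> R[i]) :
  @cmeasurable _ cT R setT f ->
  exists (N : set T) (g : T -> R[i]), [/\ measurable N, mu N = 0, cmeasurable setT g &
    forall x, ~ N x -> g x = f x].
Proof.
move=> [/completion_borel_version[N1 [g1 [mN1 N10 mg1 _ g1f]]]].
move=> /completion_borel_version[N2 [g2 [mN2 N20 mg2 _ g2f]]].
exists (N1 `|` N2), (fun x => Complex (g1 x) (g2 x)); split.
- exact: measurableU.
- by apply: null_set_setU.
- by split.
- move=> x /not_orP[N1x N2x]; rewrite g1f// g2f//=.
  by case: (f x).
Qed.

(** Here completeness enters: changing a measurable function on a null set keeps it measurable. This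
    carries measurability back from Borel versions to the original functions. *)
Lemma completion_ae_measurable (D : set T) (f g : T -> R) : measurable D ->
  {ae mu, forall x, D x -> g x = f x} -> measurable_fun D g ->
  @measurable_fun _ _ cT _ D f.
Proof.
move=> mD gf mg; apply/measurable_EFinP.
apply: (@ae_measurable_fun _ cT R cmu (@completion_complete _ _ _ mu) D
  (EFin \o g)).
  by apply/completion_ae; apply: filterS gf => x gfx Dx /=; rewrite gfx.
by apply/measurable_EFinP; exact: completion_measurable_fun.
Qed.

Lemma completion_ge0_ae_integral (D : set T) (f : T -> \bar R) (g : T -> R) :
  measurable D ->
  @measurable_fun _ _ cT _ D f -> (forall x, D x -> 0 <= f x) ->
  measurable_fun D g -> (forall x, D x -> 0 <= g x)%R ->
  {ae mu, forall x, D x -> f x = (g x)%:E} ->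
  \int[cmu]_(x in D) f x = \int[mu]_(x in D) (g x)%:E.
Proof.
move=> mD mf f0 mg g0 fg.
have mgE : measurable_fun D (EFin \o g) by exact/measurable_EFinP.
rewrite -(completion_ge0_integral mu mD mgE)//.
apply: ge0_ae_eq_integral => //.
- exact: completion_measurable.
- exact: completion_measurable_fun.
- exact/completion_ae.
Qed.

Lemma completion_ae_integrable (D : set T) (f g : T -> R) : measurable D ->
  {ae mu, forall x, D x -> g x = f x} -> mu.-integrable D (EFin \o g) ->
  cmu.-integrable D (EFin \o f) /\
  (\int[cmu]_(x in D) f x = \int[mu]_(x in D) g x)%R.
Proof.
move=> mD gf ig; have mg := measurable_int _ ig.
have cmD : @measurable _ cT D by exact: completion_measurable.
have mf : @measurable_fun _ _ cT _ D (EFin \o f).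
  by apply/measurable_EFinP; apply: completion_ae_measurable gf _ => //;
    exact/measurable_EFinP.
have cmg : @measurable_fun _ _ cT _ D (EFin \o g).
  exact: completion_measurable_fun.
have aefg : ae_eq cmu D (EFin \o f) (EFin \o g).
  by apply/completion_ae; apply: filterS gf => x gfx Dx /=; rewrite gfx.
have mabs : measurable_fun D (fun x => `|(g x)%:E|).
  exact: (measurableT_comp (@abse_measurable R setT)).
have cmabs (h : T -> R) : @measurable_fun _ _ cT _ D (EFin \o h) ->
    @measurable_fun _ _ cT _ D (fun x => `|(h x)%:E|).
  by move=> mh; exact: (measurableT_comp (@abse_measurable R setT)).
split.
  apply/integrableP; split => //.
  rewrite (ge0_ae_eq_integral cmD (cmabs _ mf) (cmabs _ cmg) _ _
    (ae_eq_abse aefg))//.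
  by rewrite completion_ge0_integral//; case/integrableP: ig.
rewrite /Rintegral (ae_eq_integral _ _ cmD mf cmg aefg); congr fine.
rewrite integralE [RHS]integralE; congr (_ - _).
  by apply: completion_ge0_integral => //; exact: measurable_funepos.
by apply: completion_ge0_integral => //; exact: measurable_funeneg.
Qed.

Lemma completion_ae_cmeasurable (D : set T) (f g : T -> R[i]) : measurable D ->
  {ae mu, forall x, D x -> g x = f x} -> cmeasurable D g ->
  @cmeasurable _ cT R D f.
Proof.
move=> mD gf [mr mi]; split.
  refine (@completion_ae_measurable D (@complex.Re R \o f) (@complex.Re R \o g) mD _ mr).
  by apply: filterS gf => x gfx Dx /=; rewrite gfx.
refine (@completion_ae_measurable D (@complex.Im R \o f) (@complex.Im R \o g) mD _ mi).
by apply: filterS gf => x gfx Dx /=; rewrite gfx.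
Qed.

Lemma completion_cLnorm (r : R) (f g : T -> R[i]) : r != 0%R ->
  {ae mu, forall x, g x = f x} -> cmeasurable setT g ->
  cLnorm cmu r f `^ r =
  \int[mu]_x (ComplexField.Normc.normc (g x) `^ r)%:E.
Proof.
move=> r0 gf mg; rewrite /cLnorm poweR_Lnorm//.
apply: (completion_ge0_ae_integral measurableT).
- apply: (measurableT_comp (measurable_poweR r)).
  apply: (measurableT_comp (@abse_measurable R setT)).
  apply/measurable_EFinP; apply: measurable_normc.
  refine (completion_ae_cmeasurable measurableT _ mg).
  by apply: filterS gf => x ->.
- by move=> x _; exact: poweR_ge0.
- exact: (measurableT_comp (measurable_powR r) (measurable_normc mg)).
- by move=> x _; exact: powR_ge0.
- by apply: filterS gf => x -> _ /=; rewrite ger0_norm ?normc_ge0.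
Qed.

End completion_functions.

(** * The upper estimate for Lebesgue measurable functions *)

Section hardy_bounded.
Local Open Scope ereal_scope.
Context (R : realType) (n m : nat).
Local Notation T n := (n.-tuple (measurableTypeR R)).
Local Notation mu n := (borel_lebesgue R n).
Local Notation normc := (@ComplexField.Normc.normc R).

Lemma measurable_box k (I : set R) : measurable (I : set (measurableTypeR R)) ->
  measurable [set t : T k | forall i, I (tnth t i)].
Proof.
move=> mI; rewrite (_ : mkset _ =
    \bigcap_(i in [set: 'I_k]) ((fun t : T k => tnth t i) @^-1` I)).
  apply: fin_bigcap_measurable => // i _.
  rewrite -[X in measurable X]setTI.
  exact: (@measurable_tnth _ (measurableTypeR R)).
by apply/seteqP; split => t H i; [move=> _|]; exact: H.
Qed.

Lemma measurable_open_cube k : @measurable _ (T k) (open_cube R k).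
Proof.
rewrite (_ : open_cube R k = [set t : T k | forall i, `]0%R, 1%R[%classic (tnth t i)]).
  exact: measurable_box.
by apply/seteqP; split => t H i; have := H i; rewrite /= in_itv.
Qed.

Lemma measurable_closed_cube k : @measurable _ (T k) (closed_cube R k).
Proof.
rewrite (_ : closed_cube R k = [set t : T k | forall i, `[0%R, 1%R]%classic (tnth t i)]).
  exact: measurable_box.
by apply/seteqP; split => t H i; have := H i; rewrite /= in_itv.
Qed.

Lemma open_cube_sub k : open_cube R k `<=` closed_cube R k.
Proof. by move=> t Ht i; have /andP[t0 t1] := Ht i; rewrite !ltW. Qed.

(** The extended integral is a difference of two Tonelli integrals, and [fine] turns infinite values
    into 0 measurably; so the statement covers every x, including those where the integral
    diverges. *)
Lemma measurable_Rintegral_snd (k : T n * T m -> R) :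
  measurable_fun setT k ->
  measurable_fun setT (fun x => (\int[mu m]_t k (x, t))%R).
Proof.
move=> mk; have mkE : measurable_fun setT (EFin \o k) by exact/measurable_EFinP.
suff mint : measurable_fun setT (fun x => \int[mu m]_t (k (x, t))%:E).
  exact: (measurableT_comp (fine_measurable measurableT) mint).
rewrite (_ : (fun x => _) = fun x =>
    \int[mu m]_t (EFin \o k)^\+ (x, t) - \int[mu m]_t (EFin \o k)^\- (x, t)).
  apply: emeasurable_funB.
    apply: (measurable_fun_fubini_tonelli_F _ (measurable_funepos mkE)).
    by move=> ?; exact: funepos_ge0.
  apply: (measurable_fun_fubini_tonelli_F _ (measurable_funeneg mkE)).
  by move=> ?; exact: funeneg_ge0.
apply/funext => x; rewrite [LHS]integralE; congr (_ - _);
  by apply: eq_integral => t _; rewrite ?funeposE ?funenegE.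
Qed.

Variable omega : Rn R m -> R.
Hypothesis omega_ge0 : (forall t, closed_cube R m t -> 0 <= omega t)%R.
Hypothesis omega_int :
  (lebesgue_Rn R m).-integrable (closed_cube R m) (EFin \o omega).

(** Cutting omega off outside the open cube before passing to a Borel version lets the integrals
    over t run over the whole space, with a weight that is nonnegative everywhere. *)
Lemma omega_borel_version : exists (N : set (T m)) (w : T m -> R),
  [/\ measurable N /\ mu m N = 0, measurable_fun setT w,
    (forall t, 0 <= w t)%R,
    (forall t, w t != 0 -> open_cube R m t)%R &
    forall t, open_cube R m t -> ~ N t -> w t = omega t].
Proof.
have mc := completion_measurable (mu m) (@measurable_closed_cube m).
have mo := completion_measurable (mu m) (@measurable_open_cube m).
have : @measurable_fun _ _ (Rn R m) _ setT (omega \_ (open_cube R m)).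
  apply/measurable_restrict => //; rewrite setTI.
  apply: (measurable_funS mc (@open_cube_sub m)).
  by apply/measurable_EFinP; case/integrableP: omega_int.
move=> /completion_borel_version[N [w [mN N0 mw wN wE]]].
exists N, w; split => //.
- move=> t; have [Nt|Nt] := pselect (N t); first by rewrite wN.
  rewrite wE// patchE; case: ifPn => // /set_mem ot.
  by apply: omega_ge0; exact: open_cube_sub.
- move=> t; have [Nt|Nt] := pselect (N t); first by rewrite wN// eqxx.
  by rewrite wE// patchE; case: ifPn => [/set_mem//|]; rewrite eqxx.
- by move=> t ot Nt; rewrite wE// patchE mem_set.
Qed.

Variables (p : R) (ps : 'I_m -> R).
Hypotheses (p1 : (1 < p)%R) (ps1 : forall i, (1 < ps i)%R).
Hypothesis pps : (p^-1 = \sum_(i < m) (ps i)^-1)%R.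

Let p0 : (0 < p)%R. Proof. exact: lt_trans p1. Qed.
Let ps0 i : (0 < ps i)%R. Proof. exact: lt_trans (ps1 i). Qed.

Lemma integral_open_cube (h : T m -> \bar R) :
  (forall t, ~ open_cube R m t -> h t = 0) ->
  \int[mu m]_(t in open_cube R m) h t = \int[mu m]_t h t.
Proof.
move=> h0; rewrite integral_mkcond; apply: eq_integral => t _.
by rewrite patchE; case: ifPn => // /negP; rewrite inE => /h0.
Qed.

Section borel_version.
Variables (N : set (T m)) (w : T m -> R).
Hypotheses (mN : measurable N) (N0 : mu m N = 0).
Hypotheses (mw : measurable_fun setT w) (w0 : (forall t, 0 <= w t)%R).
Hypothesis w_cube : (forall t, w t != 0 -> open_cube R m t)%R.
Hypothesis wE : forall t, open_cube R m t -> ~ N t -> w t = omega t.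

Lemma w_out t : ~ open_cube R m t -> w t = 0%R.
Proof. by move=> ot; apply/eqP/negP => /negP/w_cube. Qed.

Lemma ae_w_omega : {ae mu m, forall t : T m, open_cube R m t -> w t = omega t}.
Proof.
exists N; split => // t /= /not_implyP[ot wt]; apply: contrapT => Nt.
by apply: wt; exact: wE.
Qed.

Lemma hardy_constE : hardy_const n omega ps =
  \int[mu m]_t (hardy_weight n ps t * w t)%:E.
Proof.
have mhw : measurable_fun setT (fun t => hardy_weight n ps t * w t)%R.
  by apply: measurable_funM => //; exact: measurable_hardy_weight.
have aehw : {ae mu m, forall t : T m, open_cube R m t ->
    (hardy_weight n ps t * w t =
      (\prod_(i < m) crd t i `^ (- (n%:R / ps i))) * omega t)%R}.
  by have := ae_w_omega; apply: filterS => t + ot => ->.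
rewrite -integral_open_cube; last by move=> t /w_out ->; rewrite mulr0.
apply: completion_ge0_ae_integral.
- exact: measurable_open_cube.
- apply/measurable_EFinP; apply: completion_ae_measurable aehw _.
    exact: measurable_open_cube.
  exact: measurable_funTS.
- move=> t ot; rewrite lee_fin mulr_ge0//.
    by apply: prodr_ge0 => i _; exact: powR_ge0.
  by apply: omega_ge0; exact: open_cube_sub.
- exact: measurable_funTS.
- by move=> t _; rewrite mulr_ge0// hardy_weight_ge0.
- by move: aehw; apply: filterS => t + ot => /(_ ot) ->.
Qed.

Variables (A : R) (f : 'I_m -> Rn R n -> R[i]).
Hypothesis wA : \int[mu m]_t (hardy_weight n ps t * w t)%:E = A%:E.
Hypothesis Lf : forall i, cLspace (lebesgue_Rn R n) (ps i) (f i).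

Lemma hardy_bound_borel :
  [/\ hardy_dom n omega f, cLspace (lebesgue_Rn R n) p (hardy n omega f) &
    cLnorm (lebesgue_Rn R n) p (hardy n omega f) <=
      A%:E * \prod_(i < m) cLnorm (lebesgue_Rn R n) (ps i) (f i)].
Proof.
have /choice[Ng HN] i : exists Ng : set (T n) * (T n -> R[i]),
    [/\ measurable Ng.1, mu n Ng.1 = 0, cmeasurable setT Ng.2 &
      forall x, ~ Ng.1 x -> Ng.2 x = f i x].
  have [K [g [mK K0 mg gf]]] := completion_borel_cversion (Lf i).1.
  by exists (K, g).
pose K i := (Ng i).1; pose g i := (Ng i).2.
have mK i : measurable (K i) by case: (HN i).
have K0 i : mu n (K i) = 0 by case: (HN i).
have mg i : cmeasurable setT (g i) by case: (HN i).
have gf i x : ~ K i x -> g i x = f i x by case: (HN i) => _ _ _; exact.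
pose h i x := normc (g i x).
have mh i : measurable_fun setT (h i) by exact: measurable_normc.
have h0 i x : (0 <= h i x)%R by exact: normc_ge0.
have mhp i : measurable_fun setT (fun x => h i x `^ ps i)%R.
  exact: (measurableT_comp (measurable_powR _)).
have normE i : \int[mu n]_x (h i x `^ ps i)%:E =
    cLnorm (lebesgue_Rn R n) (ps i) (f i) `^ ps i.
  have fg : {ae mu n, forall x : T n, g i x = f i x}.
    by exists (K i); split => // x /= fx; apply: contrapT => Kx; apply/fx/gf.
  by rewrite (completion_cLnorm _ fg)// gt_eqF.
pose a i := fine (cLnorm (lebesgue_Rn R n) (ps i) (f i) `^ ps i).
have nfin i : cLnorm (lebesgue_Rn R n) (ps i) (f i) \is a fin_num.
  by rewrite ge0_fin_numE ?Lnorm_ge0//; exact: (Lf i).2.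
have ha i : \int[mu n]_x (h i x `^ ps i)%:E = (a i)%:E.
  by rewrite normE fineK// fin_num_poweR.
have aE i : cLnorm (lebesgue_Rn R n) (ps i) (f i) = (a i `^ (ps i)^-1)%:E.
  rewrite -poweR_EFin /a fineK ?fin_num_poweR// -poweRrM divff ?gt_eqF//.
  by rewrite poweRe1// Lnorm_ge0.
have core := hardy_borel_le p1 ps1 pps mh h0 mw w0
  (fun t wt i => proj1 (andP (w_cube wt i))) ha wA.
set B := (A * \prod_(i < m) a i `^ (ps i)^-1)%R in core.
have A0 : (0 <= A)%R.
  rewrite -lee_fin -wA; apply: integral_ge0 => t _.
  by rewrite lee_fin mulr_ge0// hardy_weight_ge0.
have B0 : (0 <= B)%R by rewrite mulr_ge0// prodr_ge0// => *; exact: powR_ge0.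
have BE : A%:E * \prod_(i < m) cLnorm (lebesgue_Rn R n) (ps i) (f i) = B%:E.
  rewrite /B EFinM -prodEFin; congr (_ * _).
  by apply: eq_bigr => i _; rewrite aE.
(* The integrand rebuilt from Borel versions; unlike the original one it is jointly measurable. *)
pose E (xt : T n * T m) : R[i] :=
  ((\prod_(i < m) g i (dilation (tnth xt.2 i) xt.1)) * (w xt.2)%:C%C)%R.
have mE : cmeasurable setT E.
  apply: cmeasurableM; last first.
    by apply: cmeasurable_real; exact: measurableT_comp.
  apply: cmeasurable_prod => i; have [mr mi] := mg i.
  by split; [apply: (measurableT_comp mr)|apply: (measurableT_comp mi)];
    exact: measurable_dilation_pair.
have normcE x t : normc (E (x, t)) = (dilation_prod h (x, t) * w t)%R.
  by rewrite ComplexField.Normc.normcM normc_prod normc_real ger0_norm.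
pose Phi x := \int[mu m]_t (dilation_prod h (x, t) * w t)%:E.
have mPhi : measurable_fun setT Phi.
  apply: (measurable_fun_fubini_tonelli_F
    (fun xt : T n * T m => (dilation_prod h xt * w xt.2)%:E)).
    apply/measurable_EFinP; apply: measurable_funM.
      exact: measurable_dilation_prod.
    exact: measurableT_comp.
  by move=> xt; rewrite lee_fin mulr_ge0// dilation_prod_ge0.
have Phi0 x : 0 <= Phi x.
  by apply: integral_ge0 => t _; rewrite lee_fin mulr_ge0// dilation_prod_ge0.
(* [core] bounds the integral of Phi^p, so Phi is finite almost everywhere. As Phi x is the integral
   of the modulus of E(x, t), this is the convergence demanded by [hardy_dom]. *)
have Phi_fin : {ae mu n, forall x : T n, Phi x < +oo}.
  have : (mu n).-integrable setT (fun x => Phi x `^ p).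
    apply/integrableP; split.
      exact: (measurableT_comp (measurable_poweR _)).
    under eq_integral do rewrite gee0_abs ?poweR_ge0//.
    by apply: le_lt_trans core _; exact: ltry.
  move=> /(integrable_ae measurableT); apply: filterS => x /(_ I).
  rewrite ge0_fin_numE ?poweR_ge0//; apply: lty_poweRy.
  by rewrite gt_eqF.
pose H x := cintegral (mu m) setT (fun t => E (x, t)).
(* For almost every x the dilates t_i x avoid all exceptional sets [K i] for almost every t in the
   cube, so there E(x, t) is the original integrand. *)
have good : {ae mu n, forall x : T n,
    [/\ cintegrable (lebesgue_Rn R m) (open_cube R m) (hardy_integrand omega f x),
        hardy n omega f x = H x & (normc (H x))%:E <= Phi x]}.
  have aeK : {ae mu n, forall x : T n, forall i, {ae mu m, forall t : T m,
      (0 < tnth t i)%R -> ~ K i (dilation (tnth t i) x)}}.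
    by apply: filter_forall => i; exact: ae_dilation_notin.
  apply: filterS2 aeK Phi_fin => x aeKx Phix.
  have mEx : cmeasurable setT (fun t => E (x, t)).
    by case: mE => mr mi; split; [exact: (measurableT_comp mr)|
      exact: (measurableT_comp mi)].
  have iEx : (mu m).-integrable setT (EFin \o normc \o (fun t => E (x, t))).
    apply/integrableP; split.
      by apply/measurable_EFinP; exact: measurable_normc.
    apply: le_lt_trans Phix; rewrite le_eqVlt; apply/orP; left; apply/eqP.
    apply: eq_integral => t _ /=; rewrite ger0_norm ?normc_ge0//.
    by rewrite normcE.
  have EF : {ae mu m, forall t : T m, open_cube R m t ->
      E (x, t) = hardy_integrand omega f x t}.
    apply: filterS2 (filter_forall _ aeKx) ae_w_omega => t Kt wt ot.
    rewrite /E /hardy_integrand wt//; congr (_ * _)%R.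
    apply: eq_bigr => i _; rewrite gf//; apply: Kt.
    by have /andP[] := ot i.
  have [iRe iIm] := normc_cintegrable measurableT mEx iEx.
  have E_out t : ~ open_cube R m t -> E (x, t) = 0%R.
    by move=> /w_out wt; rewrite /E/= wt mulr0.
  have mo := @measurable_open_cube m.
  have [iR RE] := @completion_ae_integrable _ _ _ (mu m) (open_cube R m)
    (fun t => complex.Re (hardy_integrand omega f x t))
    (fun t => complex.Re (E (x, t))) mo
    (filterS (fun t (Et : _ -> _) ot => congr1 _ (Et ot)) EF)
    (integrableS measurableT mo (@subsetT _ _) iRe).
  have [iI IE] := @completion_ae_integrable _ _ _ (mu m) (open_cube R m)
    (fun t => complex.Im (hardy_integrand omega f x t))
    (fun t => complex.Im (E (x, t))) mo
    (filterS (fun t (Et : _ -> _) ot => congr1 _ (Et ot)) EF)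
    (integrableS measurableT mo (@subsetT _ _) iIm).
  split => //.
    rewrite /hardy /H /cintegral; congr Complex.
      rewrite [LHS]RE /Rintegral integral_open_cube// => t /E_out Et.
      by rewrite Et.
    rewrite [LHS]IE /Rintegral integral_open_cube// => t /E_out Et.
    by rewrite Et.
  apply: (@le_trans _ _ (\int[mu m]_t normc (E (x, t)))%R%:E).
    by rewrite lee_fin; exact: normc_cintegral_le.
  rewrite /Rintegral fineK; last first.
    by apply: integrable_fin_num => //; exact: iEx.
  rewrite le_eqVlt; apply/orP; left; apply/eqP.
  by apply: eq_integral => t _; rewrite normcE.
(* [H] is Borel measurable on the whole space; [hardy] only agrees with it almost everywhere, and
   becomes measurable by completeness. *)
have mH : cmeasurable setT H.
  by case: mE => mr mi; split; [exact: (measurable_Rintegral_snd mr)|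
    exact: (measurable_Rintegral_snd mi)].
have Hf : {ae mu n, forall x : T n, H x = hardy n omega f x}.
  by move: good; apply: filterS => x [_ ->].
have mhf : @cmeasurable _ (Rn R n) R setT (hardy n omega f).
  refine (completion_ae_cmeasurable measurableT _ mH).
  by move: Hf; apply: filterS => x ->.
have mnH : measurable_fun setT (fun x => normc (H x)) by exact: measurable_normc.
have Lp : cLnorm (lebesgue_Rn R n) p (hardy n omega f) <= B%:E.
  have : cLnorm (lebesgue_Rn R n) p (hardy n omega f) `^ p <= B%:E `^ p.
    rewrite (completion_cLnorm _ Hf mH) ?gt_eqF//.
    apply: le_trans core; apply: ae_ge0_le_integral => //.
    - by move=> x _; rewrite lee_fin powR_ge0.
    - by apply/measurable_EFinP; exact: (measurableT_comp (measurable_powR _)).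
    - by move=> x _; exact: poweR_ge0.
    - exact: (measurableT_comp (measurable_poweR _)).
    - move: good; apply: filterS => x [_ _ le] _; rewrite -poweR_EFin.
      apply: (gt0_ler_poweR (ltW p0)) => //; rewrite in_itv/= leey andbT ?Phi0//.
  have ip0 : (0 <= p^-1)%R by rewrite invr_ge0 ltW.
  move=> le; have := gt0_ler_poweR ip0 _ _ le.
  rewrite !in_itv/= !leey !andbT !poweR_ge0 lee_fin powR_ge0 => /(_ isT isT).
  rewrite -poweRrM divff ?gt_eqF// poweRe1 ?Lnorm_ge0//.
  by rewrite ?poweR_EFin -powRrM divff ?gt_eqF// powRr1.
split; last by rewrite BE.
  by apply/completion_ae; apply: filterS good => x [].
by split => //; apply: le_lt_trans Lp _; exact: ltry.
Qed.

End borel_version.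

Lemma hardy_const_bound : hardy_const n omega ps < +oo ->
  multilinear_bounds p ps (hardy_dom n omega) (hardy n omega)
    (fine (hardy_const n omega ps)).
Proof.
have [N [w [[mN N0] mw w0 w_cube wE]]] := omega_borel_version.
rewrite (hardy_constE mN N0 mw w0 w_cube wE) => Aoo.
have A0 : 0 <= \int[mu m]_t (hardy_weight n ps t * w t)%:E.
  by apply: integral_ge0 => t _; rewrite lee_fin mulr_ge0// hardy_weight_ge0.
have wA : \int[mu m]_t (hardy_weight n ps t * w t)%:E =
    (fine (\int[mu m]_t (hardy_weight n ps t * w t)%:E))%:E.
  by rewrite fineK// ge0_fin_numE.
split=> [|f Lf]; first by rewrite fine_ge0.
exact: (hardy_bound_borel mN N0 mw w0 w_cube wE wA Lf).
Qed.

End hardy_bounded.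

(** * The density |x|^(-n) on shells *)

Section shells.
Local Open Scope ereal_scope.
Context (R : realType) (n : nat).
Local Notation T := (n.-tuple (measurableTypeR R)).
Local Notation mu := (borel_lebesgue R n).

Definition supnorm (x : T) : R := \big[Num.max/0%R]_(i < n) `|tnth x i|%R.

Lemma supnorm_ge0 x : (0 <= supnorm x)%R.
Proof.
by rewrite /supnorm; elim/big_rec: _ => // i a _ a0; rewrite le_max a0 orbT.
Qed.

Lemma measurable_supnorm : measurable_fun setT supnorm.
Proof.
rewrite /supnorm; elim: (index_enum _) => [|i s IHs].
  by rewrite (_ : (fun=> _) = cst 0%R)//; apply/funext => x; rewrite big_nil.
rewrite (_ : (fun=> _) = fun x : T =>
    Num.max `|tnth x i|%R (\big[Num.max/0%R]_(j <- s) `|tnth x j|%R)).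
  apply: measurable_maxr => //; apply: measurableT_comp => //.
  exact: (@measurable_tnth _ (measurableTypeR R)).
by apply/funext => x; rewrite big_cons.
Qed.

Lemma supnorm_dilation a x : (0 <= a)%R ->
  supnorm (dilation a x) = (a * supnorm x)%R.
Proof.
move=> a0; rewrite /supnorm; elim/big_rec2: _ => [|i u v _ ->].
  by rewrite mulr0.
by rewrite tnth_dilation normrM ger0_norm// maxr_pMr.
Qed.

Lemma supnorm_le1 x : (supnorm x <= 1)%R = `[< forall i, `|tnth x i| <= 1 >]%R.
Proof.
apply/idP/asboolP => [x1 i|x1].
  by apply: le_trans x1; exact: le_bigmax.
by apply/bigmax_leP; split.
Qed.

Lemma measurable_supnorm_le r : measurable [set x | supnorm x <= r]%R.
Proof.
rewrite (_ : mkset _ = supnorm @^-1` `]-oo, r]%classic).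
  by rewrite -[X in measurable X]setTI; apply: measurable_supnorm.
by apply/seteqP; split => x /=; rewrite in_itv.
Qed.

Definition shell (r s : R) : set T := [set x | r < supnorm x <= s]%R.

Lemma measurable_shell r s : measurable (shell r s).
Proof.
rewrite (_ : shell r s = supnorm @^-1` `]r, s]%classic).
  by rewrite -[X in measurable X]setTI; apply: measurable_supnorm.
by apply/seteqP; split => x /=; rewrite in_itv.
Qed.

Lemma measure_ball r : (0 < r)%R ->
  mu [set x | supnorm x <= r]%R = ((2 * r) ^+ n)%:E.
Proof.
move=> r0.
have mball s := measurable_supnorm_le s.
have ball1 : mu [set x | supnorm x <= 1]%R = (2 ^+ n)%:E.
  rewrite -(borel_lebesgue_box R n); congr (mu _).
  by apply/seteqP; split => x /=; rewrite supnorm_le1 => /asboolP.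
rewrite -[X in mu X = _]setIT -integral_indic//.
rewrite -(ge0_integral_dilation r0)//; last first.
  by apply/measurable_EFinP; exact: measurable_indic.
rewrite (_ : \int[mu]_x _ = \int[mu]_x (\1_[set x | supnorm x <= 1]%R x)%:E).
  rewrite integral_indic// setIT exprMn mulrC EFinM; congr (_ * _).
  exact: ball1.
apply: eq_integral => x _; rewrite !indicE; congr ((_ : bool)%:R%:E).
apply/idP/idP => /set_mem/= H; apply/mem_set => /=; move: H;
  by rewrite supnorm_dilation ?(ltW r0)// ger_pMr.
Qed.

(** The density homogeneous of degree -n, whose integral is invariant under dilation; for inner
    radius 1 it is also the p_i-th power of every test function. *)
Definition shell_density (r s : R) (x : T) : R :=
  (\1_(shell r s) x * supnorm x `^ (- n%:R))%R.

Lemma shell_density_ge0 r s x : (0 <= shell_density r s x)%R.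
Proof. by rewrite mulr_ge0// powR_ge0. Qed.

Lemma measurable_shell_density r s : measurable_fun setT (shell_density r s).
Proof.
apply: measurable_funM; first by apply: measurable_indic; exact: measurable_shell.
by apply: (measurableT_comp (measurable_powR _)); exact: measurable_supnorm.
Qed.

Definition shell_integral (r s : R) : \bar R :=
  \int[mu]_x (shell_density r s x)%:E.

(** The Jacobian a^n cancels against the factor a^(-n) taken out of (a |x|)^(-n). *)
Lemma shell_integral_scale a r s : (0 < a)%R ->
  shell_integral (a * r) (a * s) = shell_integral r s.
Proof.
move=> a0; rewrite /shell_integral -(ge0_integral_dilation a0).
- rewrite -ge0_integralZl//; last 3 first.
  + apply/measurable_EFinP; apply: (measurableT_comp (measurable_shell_density _ _)).
    exact: measurable_dilation.
  + by move=> x _; rewrite lee_fin shell_density_ge0.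
  + by rewrite lee_fin exprn_ge0// ltW.
  apply: eq_integral => x _; rewrite -EFinM /shell_density; congr (_%:E).
  rewrite supnorm_dilation ?(ltW a0)// powRM ?supnorm_ge0 ?(ltW a0)//.
  rewrite (powR_invn n (ltW a0)) mulrCA mulVKf ?expf_neq0 ?gt_eqF//.
  rewrite !indicE; congr ((_ : bool)%:R * _)%R.
  by apply/idP/idP => /set_mem/= H; apply/mem_set; move: H;
    rewrite /shell/= supnorm_dilation ?(ltW a0)// ltr_pM2l// ler_pM2l.
- by apply/measurable_EFinP; exact: measurable_shell_density.
- by move=> x; rewrite lee_fin shell_density_ge0.
Qed.

Lemma shell_integral_add r s u : (r <= s)%R -> (s <= u)%R ->
  shell_integral r u = shell_integral r s + shell_integral s u.
Proof.
move=> rs su; rewrite /shell_integral -ge0_integralD//; last 4 first.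
- by move=> x _; rewrite lee_fin shell_density_ge0.
- by apply/measurable_EFinP; exact: measurable_shell_density.
- by move=> x _; rewrite lee_fin shell_density_ge0.
- by apply/measurable_EFinP; exact: measurable_shell_density.
apply: eq_integral => x _; rewrite -EFinD /shell_density -mulrDl; congr (_ * _)%:E.
rewrite !indicE -natrD; congr (_%:R)%R.
have E v v' : (x \in shell v v') = (v < supnorm x <= v')%R.
  by apply/idP/idP => [/set_mem|?]; [|exact/mem_set].
rewrite !E; have [xs|xs] := leP (supnorm x) s.
  by rewrite (le_trans xs su) addn0.
by rewrite (le_lt_trans rs xs) andbF add0n.
Qed.

Lemma shell_integral_fin r : (1 < r)%R -> shell_integral 1 r < +oo.
Proof.
move=> r1; have r0 : (0 < r)%R by apply: lt_trans r1.
apply: (@le_lt_trans _ _ (mu [set x | supnorm x <= r]%R)); last first.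
  by rewrite measure_ball// ltry.
have mball := measurable_supnorm_le r.
rewrite -[X in _ <= mu X]setIT -integral_indic//; apply: ge0_le_integral => //.
- by move=> x _; rewrite lee_fin shell_density_ge0.
- by apply/measurable_EFinP; exact: measurable_shell_density.
- by apply/measurable_EFinP; exact: measurable_indic.
move=> x _; rewrite lee_fin /shell_density !indicE.
have [/set_mem/= /andP[x1 xr]|_] := boolP (x \in shell 1 r); last first.
  by rewrite mul0r ler0n.
rewrite mem_set// mul1r powR_invn ?supnorm_ge0// invf_le1 ?exprn_gt0 ?(lt_trans ltr01 x1)//.
by rewrite exprn_ege1// ltW.
Qed.

(** On the shell the density is at least r^(-n), and the shell has measure (2r)^n - 2^n, positive
    because n > 0. *)
Lemma shell_integral_gt0 r : (0 < n)%N -> (1 < r)%R -> 0 < shell_integral 1 r.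
Proof.
move=> n0 r1; have r0 : (0 < r)%R by apply: lt_trans r1.
have shell_gt0 : 0 < mu (shell 1 r).
  have mball s := measurable_supnorm_le s.
  rewrite (_ : shell 1 r = [set x | supnorm x <= r]%R `\` [set x | supnorm x <= 1]%R).
    rewrite measureD//; last first.
      by rewrite [ltLHS](_ : _ = ((2 * r) ^+ n)%:E) ?ltry//; exact: measure_ball.
    rewrite setIidr; last by move=> x /= x1; rewrite (le_trans x1)// ltW.
    rewrite [X in _ < X - _](_ : _ = ((2 * r) ^+ n)%:E); last exact: measure_ball.
    rewrite [X in _ < _ - X](_ : _ = ((2 * 1) ^+ n)%:E); last exact: measure_ball.
    rewrite -EFinB lte_fin subr_gt0 ltrXn2r -?lt0n// ?nnegrE ?mulr_ge0 ?(ltW r0)//.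
    by rewrite ltr_pM2l.
  apply/seteqP; split => x /=.
    by move=> /andP[x1 xr]; split => //; apply/negP; rewrite -ltNge.
  by move=> [xr /negP]; rewrite -ltNge => x1; rewrite /shell/= x1.
apply: (@lt_le_trans _ _ ((r ^- n)%:E * mu (shell 1 r))).
  by rewrite mule_gt0// lte_fin invr_gt0 exprn_gt0.
rewrite -[X in _ * mu X]setIT -integral_indic//; last exact: measurable_shell.
rewrite -ge0_integralZl//; last 2 first.
- by apply/measurable_EFinP; apply: measurable_indic; exact: measurable_shell.
- by rewrite lee_fin invr_ge0 exprn_ge0// ltW.
apply: ge0_le_integral => //.
- by move=> x _; rewrite -EFinM lee_fin mulr_ge0// invr_ge0 exprn_ge0// ltW.
- apply: measurable_funeM; apply/measurable_EFinP.
  apply: measurable_indic; exact: measurable_shell.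
- by apply/measurable_EFinP; exact: measurable_shell_density.
move=> x _; rewrite -EFinM lee_fin /shell_density mulrC !indicE.
have [/set_mem/= /andP[x1 xr]|_] := boolP (x \in shell 1 r); last by rewrite !mul0r.
rewrite !mul1r powR_invn ?supnorm_ge0// lef_pV2 ?posrE ?exprn_gt0 ?(lt_trans ltr01 x1)//.
by rewrite lerXn2r ?nnegrE ?supnorm_ge0// ltW.
Qed.

(** The first shell is split off and the rest is scaled down by r, so the integral counts shells;
    this linear growth in k is the logarithmic divergence of |x|^(-n). *)
Lemma shell_integral_pow r k : (1 < r)%R ->
  shell_integral 1 (r ^+ k.+1) = k.+1%:R%:E * shell_integral 1 r.
Proof.
move=> r1; elim: k => [|k IHk]; first by rewrite expr1 mul1e.
rewrite (@shell_integral_add _ r _ (ltW r1)); last first.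
  by rewrite -[leLHS]expr1 ler_eXn2l.
rewrite -[X in _ + shell_integral X _]mulr1 exprS shell_integral_scale ?(lt_trans ltr01)// IHk.
by rewrite -[X in X + _]mul1e -ge0_muleDl ?lee_fin.
Qed.

End shells.

(** * The lower estimate by test functions *)

Section hardy_lower.
Local Open Scope ereal_scope.
Context (R : realType) (n m : nat).
Local Notation T n := (n.-tuple (measurableTypeR R)).
Local Notation mu n := (borel_lebesgue R n).
Local Notation normc := (@ComplexField.Normc.normc R).

(** The limit of (k+2)/(k+1) in Archimedean form: k = 0 shows that x is finite, and if x > c then
    any k > c / (x - c) violates the hypothesis. *)
Lemma lee_of_ratio (x : \bar R) (c : R) : 0 <= x -> (0 <= c)%R ->
  (forall k, x * k.+1%:R%:E <= (c * k.+2%:R)%:E) -> x <= c%:E.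
Proof.
move=> x0 c0 H.
have : x < +oo.
  apply: (@le_lt_trans _ _ (c * 2)%:E); last exact: ltry.
  by have := H 0%N; rewrite mule1.
rewrite -ge0_fin_numE// => xfin; move: x0 H; rewrite -(fineK xfin).
move: (fine x) => a; rewrite !lee_fin => a0 H; rewrite leNgt; apply/negP => ca.
have ac0 : (0 < a - c)%R by rewrite subr_gt0.
have := archi_boundP (divr_ge0 c0 (ltW ac0)); set k := Num.bound _.
rewrite ltr_pdivrMr// => ka.
have := H k; rewrite -?EFinM lee_fin -(natr1 k.+1) -(natr1 k) => Hk.
by nra.
Qed.

Variable omega : Rn R m -> R.
Hypothesis omega_ge0 : (forall t, closed_cube R m t -> 0 <= omega t)%R.
Variables (N : set (T m)) (w : T m -> R).
Hypotheses (mN : measurable N) (N0 : mu m N = 0).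
Hypotheses (mw : measurable_fun setT w) (w0 : (forall t, 0 <= w t)%R).
Hypothesis w_cube : (forall t, w t != 0 -> open_cube R m t)%R.
Hypothesis wE : forall t, open_cube R m t -> ~ N t -> w t = omega t.

(** The test functions are already Borel, so only omega has to be replaced by [w]. The real part
    suffices, since it bounds the modulus from below. *)
Lemma Re_hardy_real (f : 'I_m -> T n -> R) (x : T n) :
  (forall i, measurable_fun setT (f i)) -> (forall i y, 0 <= f i y)%R ->
  cintegrable (lebesgue_Rn R m) (open_cube R m)
    (hardy_integrand omega (fun i y => (f i y)%:C%C) x) ->
  (complex.Re (hardy n omega (fun i y => (f i y)%:C%C) x))%:E =
  \int[mu m]_t (dilation_prod f (x, t) * w t)%:E.
Proof.
move=> mf f0 [iRe _].
have mo := @measurable_open_cube R m.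
have integrandE t : hardy_integrand omega (fun i y => (f i y)%:C%C) x t =
    ((dilation_prod f (x, t) * omega t)%:C)%C.
  by rewrite rmorphM /dilation_prod rmorph_prod.
have mFw : measurable_fun setT (fun t => dilation_prod f (x, t) * w t)%R.
  apply: measurable_funM => //.
  exact: (measurableT_comp (measurable_dilation_prod mf)).
have cmo : @measurable _ (Rn R m) (open_cube R m).
  exact: (completion_measurable (mu m) mo).
have fin := integrable_fin_num cmo iRe.
rewrite /hardy /cintegral /Rintegral [complex.Re _]/= fineK//.
rewrite -(@integral_open_cube _ m); last first.
  by move=> t /(w_out w_cube) ->; rewrite mulr0.
have -> : \int[lebesgue_Rn R m]_(t in open_cube R m)
    (complex.Re (hardy_integrand omega (fun i y => (f i y)%:C%C) x t))%:E =
    \int[lebesgue_Rn R m]_(t in open_cube R m)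
    (dilation_prod f (x, t) * omega t)%:E.
  by apply: eq_integral => t _; rewrite integrandE.
have miRe : @measurable_fun _ _ (Rn R m) _ (open_cube R m)
    (fun t => (dilation_prod f (x, t) * omega t)%:E).
  have := measurable_int _ iRe.
  by apply: eq_measurable_fun => t _ /=; rewrite integrandE.
apply: (completion_ge0_ae_integral mo miRe).
- move=> t ot; rewrite lee_fin mulr_ge0 ?dilation_prod_ge0//.
  by apply: omega_ge0; exact: open_cube_sub.
- exact: measurable_funTS.
- by move=> t _; rewrite mulr_ge0 ?dilation_prod_ge0.
- have := ae_w_omega mN N0 wE.
  by apply: filterS => t + ot => /(_ ot) ->.
Qed.

Variables (p : R) (ps : 'I_m -> R).
Hypotheses (n0 : (0 < n)%N) (p1 : (1 < p)%R) (ps1 : forall i, (1 < ps i)%R).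
Hypothesis pps : (p^-1 = \sum_(i < m) (ps i)^-1)%R.

Let p0 : (0 < p)%R. Proof. exact: lt_trans p1. Qed.
Let ps0 i : (0 < ps i)%R. Proof. exact: lt_trans (ps1 i). Qed.

Definition inner_cube (d : R) : set (T m) :=
  [set t | forall i, `]d, 1%R[%classic (tnth t i)].

Definition shell_test (s : R) (i : 'I_m) (x : T n) : R :=
  (\1_(shell 1 s) x * supnorm x `^ (- (n%:R / ps i)))%R.

Lemma shell_test_ge0 s i x : (0 <= shell_test s i x)%R.
Proof. by rewrite mulr_ge0// powR_ge0. Qed.

Lemma measurable_shell_test s i : measurable_fun setT (shell_test s i).
Proof.
apply: measurable_funM; first by apply: measurable_indic; exact: measurable_shell.
by apply: (measurableT_comp (measurable_powR _)); exact: measurable_supnorm.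
Qed.

Lemma shell_test_powR s i x : (shell_test s i x `^ ps i)%R = shell_density 1 s x.
Proof.
rewrite /shell_test /shell_density indicE; case: (x \in _).
  by rewrite !mul1r -powRrM mulNr divfK// gt_eqF.
by rewrite !mul0r powR0// gt_eqF.
Qed.

Lemma cLnorm_shell_test s i (K : R) : shell_integral n 1 s = K%:E ->
  cLnorm (lebesgue_Rn R n) (ps i) (fun x => (shell_test s i x)%:C%C) =
  (K `^ (ps i)^-1)%:E.
Proof.
move=> sK.
have : cLnorm (lebesgue_Rn R n) (ps i) (fun x => (shell_test s i x)%:C%C) `^ ps i =
    K%:E.
  pose f x : R[i] := (shell_test s i x)%:C%C.
  have mf : cmeasurable setT f.
    by apply: cmeasurable_real; exact: measurable_shell_test.
  have ff : {ae mu n, forall x : T n, f x = f x} by exact: aeW.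
  rewrite (completion_cLnorm _ ff mf) ?gt_eqF// -sK.
  apply: eq_integral => x _.
  by rewrite normc_real ger0_norm ?shell_test_ge0// shell_test_powR.
move=> cK; rewrite -poweR_EFin -cK -poweRrM divff ?gt_eqF// poweRe1//.
exact: Lnorm_ge0.
Qed.

(* For r < |x| <= s and r^-1 < t_i < 1 all the points t_i x lie in the shell
   where the test functions are powers of the norm. *)
Lemma dilation_prod_shell_test r s x t : (0 < r)%R -> shell r s x ->
  inner_cube r^-1 t ->
  dilation_prod (shell_test s) (x, t) =
  (hardy_weight n ps t * supnorm x `^ (- (n%:R / p)))%R.
Proof.
move=> r0 /andP[rx xs] dt.
have x0 : (0 < supnorm x)%R by apply: lt_trans rx.
have -> : (- (n%:R / p) = \sum_(i < m) - (n%:R / ps i))%R.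
  by rewrite sumrN -mulr_sumr -pps.
rewrite -powR_sum ?gt_eqF// -big_split/=; apply: eq_bigr => i _.
have := dt i; rewrite /= in_itv/= => /andP[dti ti1].
have ti0 : (0 < tnth t i)%R by apply: lt_trans dti; rewrite invr_gt0.
rewrite /shell_test supnorm_dilation ?(ltW ti0)// indicE mem_set ?mul1r.
  by rewrite powRM ?(ltW ti0) ?(ltW x0).
rewrite /shell /= supnorm_dilation ?(ltW ti0)//; apply/andP; split.
  rewrite -(mulVf (lt0r_neq0 r0)); apply: (@lt_trans _ _ (tnth t i * r)%R).
    by rewrite ltr_pM2r.
  by rewrite ltr_pM2l.
by apply: le_trans xs; rewrite ger_pMl// ltW.
Qed.

Lemma measurable_inner_cube d : measurable (inner_cube d).
Proof. exact: measurable_box. Qed.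

Lemma inner_cube_integral_le (C d : R) :
  multilinear_bounds p ps (hardy_dom n omega) (hardy n omega) C ->
  (0 < d < 1)%R ->
  \int[mu m]_(t in inner_cube d) (hardy_weight n ps t * w t)%:E <= C%:E.
Proof.
move=> [C0 HC] /andP[d0 d1]; set Ad := \int[_]_(t in _) _.
pose r : R := (d^-1)%R.
have r1 : (1 < r)%R by rewrite invf_gt1.
have r0 : (0 < r)%R by apply: lt_trans r1.
have rd : (r^-1 = d)%R by rewrite invrK.
have mhw : measurable_fun setT (fun t => hardy_weight n ps t * w t)%R.
  by apply: measurable_funM => //; exact: measurable_hardy_weight.
have hw0 t : (0 <= hardy_weight n ps t * w t)%R.
  by rewrite mulr_ge0// hardy_weight_ge0.
have Ad0 : 0 <= Ad by apply: integral_ge0 => t _; rewrite lee_fin.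
pose K1 := fine (shell_integral n 1 r).
have K1E : shell_integral n 1 r = K1%:E.
  rewrite fineK// ge0_fin_numE; first exact: shell_integral_fin.
  by apply: ltW; exact: shell_integral_gt0.
have K1_gt0 : (0 < K1)%R by rewrite -lte_fin -K1E; exact: shell_integral_gt0.
suff ratio k : Ad `^ p * k.+1%:R%:E <= (C `^ p * k.+2%:R)%:E.
  have ip0 : (0 <= p^-1)%R by rewrite invr_ge0 ltW.
  have := lee_of_ratio (poweR_ge0 _ _) (powR_ge0 _ _) ratio.
  move=> le; have := gt0_ler_poweR ip0 _ _ le.
  rewrite !in_itv/= !leey !andbT !poweR_ge0 lee_fin powR_ge0 => /(_ isT isT).
  rewrite -poweRrM divff ?gt_eqF// poweRe1//.
  by rewrite ?poweR_EFin -powRrM divff ?gt_eqF// powRr1.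
(* The test functions occupy k+2 consecutive shells of ratio r, while the estimate from below holds
   only beyond r, on k+1 of them. *)
pose s : R := (r ^+ k.+2)%R.
pose Ks : R := (k.+2%:R * K1)%R.
have Ks0 : (0 < Ks)%R by rewrite mulr_gt0.
have sK : shell_integral n 1 s = Ks%:E by rewrite shell_integral_pow// K1E.
have rsK : shell_integral n r s = (k.+1%:R * K1)%:E.
  by rewrite -{1}(mulr1 r) /s exprS shell_integral_scale// shell_integral_pow// K1E.
pose f i (x : Rn R n) : R[i] := (shell_test s i x)%:C%C.
have mf i : cmeasurable setT (f i : T n -> R[i]).
  by apply: cmeasurable_real; exact: measurable_shell_test.
have Lf i : cLspace (lebesgue_Rn R n) (ps i) (f i).
  split; last by rewrite (cLnorm_shell_test _ sK) ltry.
  by refine (@completion_ae_cmeasurable _ _ _ (mu n) _ _ (f i) measurableT _ (mf i));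
    exact: aeW.
have [domf [mhf _] le] := HC f Lf.
have {}le : \int[lebesgue_Rn R n]_x (`|(normc (hardy n omega f x))%:E| `^ p) <=
    (C `^ p * Ks)%:E.
  rewrite -[leLHS](@poweR_Lnorm _ _ _ _ (EFin \o normc \o hardy n omega f)) ?gt_eqF//.
  have := gt0_ler_poweR (ltW p0) _ _ le.
  rewrite !in_itv/= !leey !andbT Lnorm_ge0 mule_ge0 ?lee_fin//; last first.
    by apply: prode_ge0 => i _; exact: Lnorm_ge0.
  move=> /(_ isT isT) /le_trans; apply.
  (* Since 1/p is the sum of the 1/p_i, the product of the norms is Ks^(1/p), and its p-th power is
     Ks. *)
  rewrite (eq_bigr (fun i => (Ks `^ (ps i)^-1)%:E)); last first.
    by move=> i _; exact: cLnorm_shell_test.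
  rewrite prodEFin powR_sum ?gt_eqF// -pps -EFinM poweR_EFin lee_fin.
  by rewrite powRM ?powR_ge0// -powRrM mulVf ?gt_eqF// powRr1// ltW.
have ge : Ad `^ p * (k.+1%:R * K1)%:E <=
    \int[lebesgue_Rn R n]_x (`|(normc (hardy n omega f x))%:E| `^ p).
  have msd : measurable_fun setT (fun x : T n => (shell_density r s x)%:E).
    by apply/measurable_EFinP; exact: measurable_shell_density.
  rewrite -rsK /shell_integral -ge0_integralZl//; last 2 first.
  - by move=> x _; rewrite lee_fin shell_density_ge0.
  - exact: poweR_ge0.
  have msdA : measurable_fun setT
      (fun x : T n => Ad `^ p * (shell_density r s x)%:E).
    exact: measurable_funeM.
  have msdA0 x : [set: T n] x -> 0 <= Ad `^ p * (shell_density r s x)%:E.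
    by move=> _; rewrite mule_ge0 ?poweR_ge0// lee_fin shell_density_ge0.
  rewrite -(completion_ge0_integral (mu n) measurableT msdA msdA0).
  have msdAc := completion_measurable_fun (mu := mu n) measurableT msdA.
  apply: (ae_ge0_le_integral (mu := lebesgue_Rn R n) measurableT msdA0 msdAc).
  - by move=> x _; exact: poweR_ge0.
  - apply: (measurableT_comp (measurable_poweR p)).
    apply: (measurableT_comp (@abse_measurable R setT)).
    by apply/measurable_EFinP; exact: measurable_normc.
  move: domf; apply: filterS => x ix _.
  have [xs|xs] := pselect (shell r s x); last first.
    by rewrite /shell_density indicE memNset// mul0r mule0 poweR_ge0.
  rewrite /shell_density indicE mem_set// mul1r.
  (* Writing |x|^(-n) as a p-th power reduces the claim to a pointwise comparison of Ad |x|^(-n/p)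
     with the modulus of the operator's value. *)
  have -> : (supnorm x `^ (- n%:R))%:E = (supnorm x `^ (- (n%:R / p)))%:E `^ p.
    by rewrite poweR_EFin -powRrM mulNr divfK// gt_eqF.
  rewrite -poweRM ?lee_fin ?powR_ge0//.
  apply: (gt0_ler_poweR (ltW p0)).
  - by rewrite in_itv/= leey andbT mule_ge0// lee_fin powR_ge0.
  - by rewrite in_itv/= leey andbT lee_fin normr_ge0.
  rewrite gee0_abs ?lee_fin ?normc_ge0//.
  apply: (@le_trans _ _ (complex.Re (hardy n omega f x))%:E); last first.
    by rewrite lee_fin (le_trans _ (normr_Re_le _))// ler_norm.
  rewrite Re_hardy_real//; last 2 first.
  - by move=> i; exact: measurable_shell_test.
  - by move=> i y; exact: shell_test_ge0.
  have md := @measurable_inner_cube d.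
  have mdp : measurable_fun setT
      (fun t => (dilation_prod (shell_test s) (x, t) * w t)%:E).
    apply/measurable_EFinP; apply: measurable_funM => //.
    apply: (measurableT_comp (measurable_dilation_prod _)) => //.
    by move=> i; exact: measurable_shell_test.
  have dp0 t : 0 <= (dilation_prod (shell_test s) (x, t) * w t)%:E.
    by rewrite lee_fin mulr_ge0// dilation_prod_ge0// => i y; exact: shell_test_ge0.
  apply: (@le_trans _ _ (\int[mu m]_(t in inner_cube d)
      (dilation_prod (shell_test s) (x, t) * w t)%:E)); last first.
    exact: ge0_subset_integral.
  rewrite /Ad muleC -ge0_integralZl ?lee_fin ?powR_ge0//; last 2 first.
  - by apply/measurable_EFinP; exact: measurable_funTS.
  - by move=> t _; rewrite lee_fin.
  rewrite le_eqVlt; apply/orP; left; apply/eqP; apply: eq_integral => t /set_mem td.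
  rewrite (dilation_prod_shell_test r0 xs) ?rd// -EFinM; congr (_%:E).
  by rewrite mulrCA mulrA.
have := le_trans ge le.
rewrite /Ks mulrA EFinM [in X in _ <= X]EFinM muleA lee_pmul2r ?lte_fin//.
Qed.

Lemma hardy_const_le (C : R) :
  multilinear_bounds p ps (hardy_dom n omega) (hardy n omega) C ->
  \int[mu m]_t (hardy_weight n ps t * w t)%:E <= C%:E.
Proof.
(* The shift to k+2 keeps the lower cutoff strictly below 1 already at k = 0. The sets [F k]
   increase to the open cube, so monotone convergence recovers the full constant. *)
move=> HC; pose F k := inner_cube (k.+2%:R^-1 : R).
have mhw : measurable_fun setT (fun t => hardy_weight n ps t * w t)%R.
  by apply: measurable_funM => //; exact: measurable_hardy_weight.
have UF : \bigcup_k F k = open_cube R m.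
  apply/seteqP; split => [t [k _ Ft] i|t ot].
    have := Ft i; rewrite /= in_itv/= => /andP[ti ->]; rewrite andbT.
    by apply: lt_trans ti; rewrite invr_gt0.
  have : \forall k \near \oo, forall i, (k.+1%:R^-1 < tnth t i :> R)%R.
    apply: filter_forall => i; have /andP[ti0 _] := ot i.
    exact: (near_infty_natSinv_lt (PosNum ti0)).
  move=> [k _ /(_ k (leqnn k)) kt]; exists k => // i; rewrite /= in_itv/=.
  have /andP[_ ->] := ot i; rewrite andbT; apply: le_lt_trans (kt i).
  by rewrite lef_pV2 ?posrE// ler_nat.
rewrite -(@integral_open_cube _ m); last by move=> t /(w_out w_cube) ->; rewrite mulr0.
rewrite -UF.
have cvgF : \int[mu m]_(t in F k) (hardy_weight n ps t * w t)%:E @[k --> \oo] -->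
    \int[mu m]_(t in \bigcup_k F k) (hardy_weight n ps t * w t)%:E.
  apply: ge0_nondecreasing_set_cvg_integral.
  - move=> k l kl; apply/subsetPset => t Ft i.
    have := Ft i; rewrite /= !in_itv/= => /andP[ti ->]; rewrite andbT.
    by apply: le_lt_trans ti; rewrite lef_pV2 ?posrE// ler_nat.
  - by move=> k; exact: measurable_inner_cube.
  - by move=> k; apply/measurable_EFinP; exact: measurable_funTS.
  - by move=> k t _; rewrite lee_fin mulr_ge0// hardy_weight_ge0.
rewrite -(cvg_lim _ cvgF)//; apply: lime_le; first by apply/cvg_ex; eexists; exact: cvgF.
apply: nearW => k; apply: inner_cube_integral_le => //.
by rewrite invr_gt0 ltr0n invf_lt1 ?ltr0n// ltr1n.
Qed.

End hardy_lower.

(** * Boundedness criterion and norm formula *)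

Theorem theorem2p1 (R : realType) (n m : nat) (hn : (0 < n)%N) (hm : (0 < m)%N)
    (omega : Rn R m -> R)
    (omega_ge0 : forall t, closed_cube R m t -> 0 <= omega t)
    (omega_int :
      (lebesgue_Rn R m).-integrable (closed_cube R m) (EFin \o omega))
    (p : R) (ps : 'I_m -> R) (hp : 1 < p) (hps : forall i, 1 < ps i)
    (hpps : p^-1 = \sum_(i < m) (ps i)^-1) :
  (multilinear_bounded p ps (hardy_dom n omega) (hardy n omega) <->
    (hardy_const n omega ps < +oo)%E) /\
  operator_norm p ps (hardy_dom n omega) (hardy n omega) =
    hardy_const n omega ps.
Proof.
have [N [w [[mN N0] mw w0 w_cube wE]]] := omega_borel_version omega_ge0 omega_int.
have lower C : multilinear_bounds p ps (hardy_dom n omega) (hardy n omega) C ->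
    (hardy_const n omega ps <= C%:E)%E.
  rewrite (hardy_constE n omega_ge0 ps mN N0 mw w0 w_cube wE).
  exact: (hardy_const_le omega_ge0 mN N0 mw w0 w_cube wE hn hp hps hpps).
have upper := hardy_const_bound omega_ge0 omega_int hp hps hpps.
have const_ge0 : (0 <= hardy_const n omega ps)%E.
  apply: integral_ge0 => t ot; rewrite lee_fin mulr_ge0//.
    by apply: prodr_ge0 => i _; exact: powR_ge0.
  by apply: omega_ge0; exact: open_cube_sub.
have bounded : multilinear_bounded p ps (hardy_dom n omega) (hardy n omega) <->
    (hardy_const n omega ps < +oo)%E.
  split=> [[C /lower] /le_lt_trans|/upper]; first by apply; exact: ltry.
  by exists (fine (hardy_const n omega ps)).
split=> //; apply/eqP; rewrite eq_le; apply/andP; split; last first.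
  by apply/le_ereal_inf_tmp => _ [C HC <-]; exact: lower.
(* A finite constant is itself an admissible bound, hence at least the infimum; for an infinite one
   this inequality is trivial. *)
have [Aoo|] := ltP (hardy_const n omega ps) +oo%E; last first.
  by rewrite leye_eq => /eqP ->; exact: leey.
apply: ereal_inf_lbound; exists (fine (hardy_const n omega ps)); first exact: upper.
by rewrite fineK// ge0_fin_numE.
Qed.
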